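(* Let $R$ be a commutative ring, $r_1,\dots,r_m\in R$ a finite set of elements, and $F$ a flat $R$-module. Then $F$ is $\mathbf r^\times$-very flat if and only if for every subset $J\subset\{1,\dots,m\}$ the $R_J$-module $R_J\otimes_RF$ is projective.
   Context: For $J\subset\{1,\dots,m\}$ put $r_J=\prod_{j\in J}r_j$ (with $r_\emptyset=1$), $K=\{1,\dots,m\}\setminus J$, and $R_J=\bigl(R/\sum_{k\in K}r_kR\bigr)[r_J^{-1}]$ (annihilate the $r_k$, $k\in K$, and invert the $r_j$, $j\in J$). Let $\mathbf r^\times=\{r_J: J\subset\{1,\dots,m\}\}$. For a finite set $\mathbf s\subset R$, an $R$-module $C$ is $\mathbf s$-contraadjusted if $\mathrm{Ext}^1_R(R[s^{-1}],C)=0$ for all $s\in\mathbf s$, where $R[s^{-1}]$ is the localization at the powers of $s$; an $R$-module $F$ is $\mathbf s$-very flat if $\mathrm{Ext}^1_R(F,C)=0$ for every $\mathbf s$-contraadjusted $R$-module $C$. *)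

(* Defs.v *)
From HB Require Import structures.
From mathcomp Require Import all_boot all_order all_algebra.
Set Implicit Arguments. Unset Strict Implicit. Unset Printing Implicit Defensive.
Import GRing.Theory.
Local Open Scope ring_scope.

Section Defs.
Variable R : comPzRingType.

(* Ext^1_R(A, C) = 0, in Yoneda form: every extension 0 -> C -> E -> A -> 0
   of R-modules splits. *)
Definition Ext1_vanishes (A C : lmodType R) : Prop :=
  forall (E : lmodType R) (i : C -> E) (p : E -> A),
    linear i -> linear p -> injective i ->
    (forall a, exists e, p e = a) ->
    (forall e, p e = 0 <-> exists c, i c = e) ->
    exists s : A -> E, linear s /\ forall a, p (s a) = a.

Definition s_bijective (s : R) (N : lmodType R) : Prop :=
  bijective (fun x : N => s *: x).

Definition is_localization (s : R) (L : lmodType R) (l : R^o -> L) : Prop :=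
  linear l /\ s_bijective s L /\
  forall (N : lmodType R) (h : R^o -> N), linear h -> s_bijective s N ->
    exists g : L -> N, (linear g /\ forall x, g (l x) = h x) /\
      forall g' : L -> N, linear g' -> (forall x, g' (l x) = h x) -> g' =1 g.

Definition contraadjusted (sset : R -> Prop) (C : lmodType R) : Prop :=
  forall s, sset s ->
    forall (L : lmodType R) (l : R^o -> L), is_localization s l ->
      Ext1_vanishes L C.

Definition very_flat (sset : R -> Prop) (F : lmodType R) : Prop :=
  forall C : lmodType R, contraadjusted sset C -> Ext1_vanishes F C.

Definition bilinear (A F M : lmodType R) (b : A -> F -> M) : Prop :=
  (forall x, linear (fun a => b a x)) /\ (forall a, linear (b a)).

Definition is_tensor (A F T : lmodType R) (t : A -> F -> T) : Prop :=
  bilinear t /\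
  forall (M : lmodType R) (b : A -> F -> M), bilinear b ->
    exists g : T -> M, (linear g /\ forall a x, g (t a x) = b a x) /\
      forall g' : T -> M, linear g' -> (forall a x, g' (t a x) = b a x) ->
        g' =1 g.

Definition flat (F : lmodType R) : Prop :=
  forall (A B : lmodType R) (f : A -> B), linear f -> injective f ->
  forall (TA TB : lmodType R) (tA : A -> F -> TA) (tB : B -> F -> TB),
    is_tensor tA -> is_tensor tB ->
    forall g : TA -> TB, linear g -> (forall a x, g (tA a x) = tB (f a) x) ->
      injective g.

Definition rtimes (m : nat) (r : 'I_m -> R) (s : R) : Prop :=
  exists J : {set 'I_m}, s = \prod_(j in J) r j.

(* (S, phi) is R_J = (R / sum_{k notin J} r_k R)[r_J^{-1}], via its universal
   property among commutative rings under R. *)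
Definition ring_cond (m : nat) (r : 'I_m -> R) (J : {set 'I_m})
    (T : comPzRingType) (psi : {rmorphism R -> T}) : Prop :=
  (forall k, k \notin J -> psi (r k) = 0) /\
  (forall j, j \in J -> exists y : T, psi (r j) * y = 1).

Definition is_RJ (m : nat) (r : 'I_m -> R) (J : {set 'I_m})
    (S : comPzRingType) (phi : {rmorphism R -> S}) : Prop :=
  ring_cond r J phi /\
  forall (T : comPzRingType) (psi : {rmorphism R -> T}), ring_cond r J psi ->
    exists chi : {rmorphism S -> T}, (forall x, chi (phi x) = psi x) /\
      forall chi' : {rmorphism S -> T}, (forall x, chi' (phi x) = psi x) ->
        chi' =1 chi.

Definition phi_linear (S : comPzRingType) (phi : {rmorphism R -> S})
    (F : lmodType R) (N : lmodType S) (h : F -> N) : Prop :=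
  (forall x y, h (x + y) = h x + h y) /\
  (forall (a : R) x, h (a *: x) = phi a *: h x).

Definition is_base_change (S : comPzRingType) (phi : {rmorphism R -> S})
    (F : lmodType R) (P : lmodType S) (tau : F -> P) : Prop :=
  phi_linear phi tau /\
  forall (N : lmodType S) (h : F -> N), phi_linear phi h ->
    exists g : P -> N, (linear g /\ forall x, g (tau x) = h x) /\
      forall g' : P -> N, linear g' -> (forall x, g' (tau x) = h x) -> g' =1 g.

End Defs.

Definition projective (S : comPzRingType) (P : lmodType S) : Prop :=
  forall (M N : lmodType S) (p : M -> N) (f : P -> N),
    linear p -> linear f -> (forall y, exists x, p x = y) ->
    exists g : P -> M, linear g /\ forall x, p (g x) = f x.

(* Main.v *)
Require Import Defs.
From HB Require Import structures.
From mathcomp Require Import all_boot all_order all_algebra.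
From mathcomp Require Import boolp functions.
Set Implicit Arguments. Unset Strict Implicit. Unset Printing Implicit Defensive.
Import GRing.Theory.
Local Open Scope ring_scope.

(** Fix a presentation 0 -> H -> G -> F -> 0 with G free on the set F.

    If D is an R_J-module, then D is r^x-contraadjusted as an R-module: for
    I not contained in J some r_k, k in I, kills D and is invertible on
    R[1/r_I]; for I contained in J every extension of R[1/r_I] by D is an
    R[1/r_I]-module.  Pulling back an epimorphism of R_J-modules to F therefore
    proves that very flatness implies projectivity of R_J (x) F.

    Conversely, for disjoint Z, U one shows that every map h : H -> C extends
    to G when the r_k (k in Z) kill C, r_U is invertible on C, and C is
    contraadjusted, by induction on the number of remaining indices.  If
    none remain, flatness makes C embed in the reflection of the pushout
    extension into R_J-modules, where projectivity splits it.  Otherwise pick a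
    remaining r.  The case (Z + r, U) applied to C/rC, together with the
    splitting of an extension of H by C[r], gives h = g|_H + r h' with g
    defined on G; iterating, h_n = g_n|_H + r h_(n+1).  As C is contraadjusted,
    g_n = d_n - r d_(n+1) is solvable in Hom(G, C), so k_n = h_n - d_n satisfies
    k_n = r k_(n+1): the k_n form a map from H to a module on which r is
    invertible, which extends to G by the case (Z, U + r). *)

(** * Submodules and quotient modules given by a predicate *)

Definition is_submod (R : pzRingType) (X : lmodType R) (W : X -> Prop) : Prop :=
  W 0 /\ forall a x y, W x -> W y -> W (a *: x + y).

Section SubmodPred.
Variables (R : pzRingType) (X : lmodType R) (W : X -> Prop) (hW : is_submod W).

Definition submod_pred of is_submod W : {pred X} := fun x => `[< W x >].

Lemma submod_pred_closed : submod_closed (submod_pred hW).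
Proof.
split; first exact/asboolP/(proj1 hW).
by move=> a x y /asboolP Wx /asboolP Wy; apply/asboolP/(proj2 hW).
Qed.

HB.instance Definition _ :=
  GRing.isSubmodClosed.Build R X (submod_pred hW) submod_pred_closed.

Record submod_type := SubmodType {
  submod_val :> X; submod_valP : submod_val \in submod_pred hW }.
HB.instance Definition _ := [isSub for submod_val].
HB.instance Definition _ := [Choice of submod_type by <:].
HB.instance Definition _ := [SubChoice_isSubLmodule of submod_type by <:].

Notation Q := (Quotient.quot (submod_pred hW)).

Definition quot_scale (a : R) (x : Q) : Q := \pi_Q%qT (a *: repr x).

Lemma pi_quot_scale a (x : X) : \pi_Q%qT (a *: x) = quot_scale a (\pi_Q%qT x).
Proof.
rewrite /quot_scale; apply/eqP; rewrite -Quotient.idealrBE -scalerBr.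
by apply: rpredZ; rewrite Quotient.idealrBE reprK; apply/eqP.
Qed.

Lemma quot_scalerA a b x : quot_scale a (quot_scale b x) = quot_scale (a * b) x.
Proof. by elim/quotW: x => x; rewrite -(pi_quot_scale b x) -!pi_quot_scale scalerA. Qed.
Lemma quot_scale1r : left_id 1 quot_scale.
Proof. by elim/quotW=> x; rewrite -pi_quot_scale scale1r. Qed.
Lemma quot_scalerDr : right_distributive quot_scale +%R.
Proof.
move=> a; elim/quotW=> x; elim/quotW=> y.
by rewrite -!pi_quot_scale -[in LHS]raddfD -[RHS]raddfD -pi_quot_scale scalerDr.
Qed.
Lemma quot_scalerDl x : {morph quot_scale^~ x : a b / a + b}.
Proof. by elim/quotW: x => x a b; rewrite -!pi_quot_scale scalerDl raddfD. Qed.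

HB.instance Definition _ := GRing.Zmodule_isLmodule.Build R Q
  quot_scalerA quot_scale1r quot_scalerDr quot_scalerDl.

Lemma sub_exists : exists (Y : lmodType R) (i : Y -> X),
  [/\ linear i, injective i & forall x, W x <-> exists y, i y = x].
Proof.
exists submod_type, submod_val; split.
- by move=> a x y; exact: (linearP (val : submod_type -> X)).
- exact: val_inj.
- move=> x; split=> [Wx|[y <-]]; last exact/asboolP/submod_valP.
  by exists (SubmodType (asboolT Wx)).
Qed.

Lemma quot_exists : exists (Y : lmodType R) (q : X -> Y),
  [/\ linear q, forall y, exists x, q x = y & forall x, q x = 0 <-> W x].
Proof.
exists Q, \pi_Q%qT; split.
- by move=> a x y; rewrite raddfD; congr (_ + _); exact: pi_quot_scale.
- by move=> y; exists (repr y); rewrite reprK.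
- move=> x; rewrite -(raddf0 (\pi_Q%qT)); split.
    by move/eqP; rewrite -Quotient.idealrBE subr0 => /asboolP.
  by move=> Wx; apply/eqP; rewrite -Quotient.idealrBE subr0; apply/asboolP.
Qed.

End SubmodPred.

Lemma ex_choice X Y (P : X -> Y -> Prop) :
  (forall x, exists y, P x y) -> exists f, forall x, P x (f x).
Proof. by move=> /choice[f hf]; exists f. Qed.

(** * Linear maps as plain functions, and as functional relations *)

Section LinearProp.
Variables (R : pzRingType) (U V : lmodType R) (f : U -> V) (hf : linear f).

Let g : {linear U -> V} := HB.pack f (GRing.isLinear.Build R U V *:%R f hf).

Lemma lin0 : f 0 = 0. Proof. exact: (linear0 g). Qed.
Lemma linD x y : f (x + y) = f x + f y. Proof. exact: (linearD g). Qed.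
Lemma linB x y : f (x - y) = f x - f y. Proof. exact: (linearB g). Qed.
Lemma linN x : f (- x) = - f x. Proof. exact: (linearN g). Qed.
Lemma linZ a x : f (a *: x) = a *: f x.
Proof. by rewrite -[a *: x]addr0 hf lin0 addr0. Qed.
Lemma lin_sum I (s : seq I) (P : pred I) (F : I -> U) :
  f (\sum_(i <- s | P i) F i) = \sum_(i <- s | P i) f (F i).
Proof. exact: (linear_sum g). Qed.

Lemma lin_inj : (forall x, f x = 0 -> x = 0) -> injective f.
Proof.
move=> h x y e; apply/eqP; rewrite -subr_eq0; apply/eqP/h.
by rewrite linB e subrr.
Qed.

End LinearProp.

Section SubmodTheory.
Variables (R : pzRingType) (X : lmodType R) (W : X -> Prop) (hW : is_submod W).

Lemma submod0 : W 0. Proof. exact: (proj1 hW). Qed.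
Lemma submodD x y : W x -> W y -> W (x + y).
Proof. by move=> Wx Wy; rewrite -(scale1r x); exact: (proj2 hW). Qed.
Lemma submodZ a x : W x -> W (a *: x).
Proof. by move=> Wx; rewrite -[_ *: _]addr0; exact/(proj2 hW)/submod0. Qed.
Lemma submodN x : W x -> W (- x).
Proof. by rewrite -scaleN1r; exact: submodZ. Qed.
End SubmodTheory.

(** This defines maps out of colimits and quotients without choosing representatives. A difference
    of two values at [x] is a value at 0, so uniqueness at 0 suffices. *)
Lemma linear_of_relation (R : pzRingType) (X D : lmodType R) (Q : X -> D -> Prop) :
  (forall x, exists d, Q x d) ->
  (forall a x y d e, Q x d -> Q y e -> Q (a *: x + y) (a *: d + e)) ->
  (forall d, Q 0 d -> d = 0) ->
  exists f : X -> D, [/\ linear f, forall x, Q x (f x) &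
                        forall x d, Q x d -> f x = d].
Proof.
move=> tot cl z; have [f hf] := ex_choice tot.
have un x d e : Q x d -> Q x e -> d = e.
  move=> qd qe; apply/eqP; rewrite -subr_eq0 addrC -scaleN1r; apply/eqP/z.
  by rewrite -(addNr x) -scaleN1r; exact: cl.
exists f; split=> // [a x y|x d]; last by move/(un _ _ _ (hf x)).
by apply: un (hf _) _; exact: cl.
Qed.

(** * Direct sums of copies of a module *)

Section DirectSum.
Variables (R : pzRingType) (I : choiceType) (A : lmodType R).

Lemma sum_supp (M : nmodType) (F : I -> M) (s u : seq I) :
  uniq s -> uniq u -> {subset s <= u} -> (forall i, i \notin s -> F i = 0) ->
  \sum_(i <- s) F i = \sum_(i <- u) F i.
Proof.
move=> us uu su h.
rewrite [RHS](bigID (mem s)) /= [X in _ + X]big1 ?addr0; last by move=> i /h.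
rewrite -[RHS]big_filter; apply: perm_big; apply: uniq_perm => //.
  exact: filter_uniq.
by move=> i; rewrite mem_filter; case: (boolP (i \in s)) => // /su ->.
Qed.

(** The elements are the functions [I -> A] vanishing off a finite list; the map induced by [b] sums
    over any such list. *)
Lemma direct_sum_exists : exists (X : lmodType R) (io : I -> A -> X) (c : X -> I -> A),
  [/\ forall i, linear (io i), forall i, linear (fun x => c x i),
      forall i a j, c (io i a) j = if j == i then a else 0,
      forall x, exists s, x = \sum_(i <- s) io i (c x i) &
      forall (M : lmodType R) (b : I -> A -> M), (forall i, linear (b i)) ->
        exists be : X -> M, linear be /\ forall i a, be (io i a) = b i a].
Proof.
pose W (f : I -> A) := exists s : seq I, uniq s /\ forall i, i \notin s -> f i = 0.
have hW : is_submod W.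
  split; first by exists [::].
  move=> a x y [s [us hs]] [t [ut ht]]; exists (undup (s ++ t)).
  rewrite undup_uniq; split=> // i; rewrite mem_undup mem_cat negb_or.
  case/andP=> /hs hi /ht hj.
  by rewrite addrfctE scalrfctE hi hj scaler0 add0r.
have [X [v [lv iv vW]]] := sub_exists hW.
have hio i a : W (fun j => if j == i then a else 0).
  by exists [:: i]; split=> // j; rewrite inE => /negbTE ->.
have [io1 hio1] : exists io1 : I * A -> X,
    forall p, v (io1 p) = fun j => if j == p.1 then p.2 else 0.
  apply: (@ex_choice _ _
    (fun p x => v x = fun j => if j == p.1 then p.2 else 0)) => -[i a].
  by apply/vW; exact: hio.
pose io i a := io1 (i, a).
have hc i : linear (fun x => v x i).
  by move=> a x y; rewrite lv addrfctE scalrfctE.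
have cio i a j : v (io i a) j = if j == i then a else 0 by rewrite hio1.
have lio i : linear (io i).
  move=> a x y; apply: iv; apply/funext => j; rewrite lv.
  rewrite addrfctE scalrfctE !cio; case: ifP => // _.
  by rewrite scaler0 addr0.
have supp x : exists s : seq I, uniq s /\ forall i, i \notin s -> v x i = 0.
  by apply/vW; exists x.
exists X, io, v; split=> // [x|M b lb].
- have [s [us hs]] := supp x; exists s; apply: iv; apply/funext => j.
  rewrite (lin_sum (hc j)) (eq_bigr (fun i => if j == i then v x i else 0)); last first.
    by move=> i _; rewrite cio.
  case: (boolP (j \in s)) => js.
    rewrite (bigD1_seq j) //= eqxx big1 ?addr0 // => i /negbTE.
    by rewrite eq_sym => ->.
  rewrite big_seq big1 ?hs // => i si; case: eqP => // ji.
  by rewrite ji si in js.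
- pose Q x d := exists s : seq I, [/\ uniq s, forall i, i \notin s -> v x i = 0 &
    d = \sum_(i <- s) b i (v x i)].
  have [||_ [s [us hs ->]]|be [lbe _ be2]] := @linear_of_relation R X M Q.
  + by move=> x; have [s [us hs]] := supp x; exists (\sum_(i <- s) b i (v x i)), s.
  (* Both sums are extended by zero terms to the common list [w]. *)
  + move=> a x y _ _ [s [us hs ->]] [t [ut ht ->]]; pose w := undup (s ++ t).
    exists w; split=> [|i|]; first exact: undup_uniq.
      rewrite mem_undup mem_cat negb_or => /andP[/hs hi /ht hj].
      by rewrite (hc i) hi hj scaler0 add0r.
    rewrite (@sum_supp _ _ s w) ?undup_uniq //; last 2 first.
    * by move=> i si; rewrite mem_undup mem_cat si.
    * by move=> i /hs ->; rewrite (lin0 (lb i)).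
    rewrite (@sum_supp _ _ t w) ?undup_uniq //; last 2 first.
    * by move=> i si; rewrite mem_undup mem_cat si orbT.
    * by move=> i /ht ->; rewrite (lin0 (lb i)).
    rewrite scaler_sumr -big_split; apply: eq_bigr => i _ /=.
    by rewrite (hc i) (lb i).
  + by rewrite big1 // => i _; rewrite (lin0 (hc i)) (lin0 (lb i)).
  + exists be; split=> // i a; apply: be2; exists [:: i]; split=> // [j|].
      by rewrite inE => /negbTE ji; rewrite cio ji.
    by rewrite big_seq1 cio eqxx.
Qed.

End DirectSum.

Lemma inj_surj_bij (X Y : Type) (f : X -> Y) :
  injective f -> (forall y, exists x, f x = y) -> bijective f.
Proof.
move=> fi fs; have [g hg] := ex_choice fs.
by exists g => // x; apply: fi; rewrite hg.
Qed.

Lemma quot_factor (R : pzRingType) (X Y D : lmodType R) (q : X -> Y) (h : X -> D) :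
  linear q -> (forall y, exists x, q x = y) -> linear h ->
  (forall x, q x = 0 -> h x = 0) ->
  exists g : Y -> D, linear g /\ forall x, g (q x) = h x.
Proof.
move=> lq sq lh k.
have [|||g [lg _ gE]] := @linear_of_relation R Y D
  (fun y d => exists2 x, q x = y & h x = d).
- by move=> y; have [x qx] := sq y; exists (h x), x.
- move=> a _ _ _ _ [x <- <-] [x' <- <-]; exists (a *: x + x'); by rewrite ?lq ?lh.
- by move=> d [x /k -> <-].
by exists g; split=> // x; apply: gE; exists x.
Qed.

Lemma bijective_sub_scale (R : comPzRingType) (s : R) (X Y : lmodType R) (i : Y -> X) :
  linear i -> injective i -> s_bijective s X ->
  (forall y x, s *: x = i y -> exists y', i y' = x) -> s_bijective s Y.
Proof.
move=> li ii [g gK Kg] h; apply: inj_surj_bij => [x y e|y].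
  apply: ii; apply: (can_inj gK) => /=.
  by rewrite -!(linZ li) e.
have [y' hy'] := h y (g (i y)) (Kg _).
by exists y'; apply: ii; rewrite (linZ li) hy' Kg.
Qed.

Lemma bijective_quot_scale (R : comPzRingType) (s : R) (X Y : lmodType R) (q : X -> Y) :
  linear q -> (forall y, exists x, q x = y) -> s_bijective s X ->
  (forall x, q (s *: x) = 0 -> q x = 0) -> s_bijective s Y.
Proof.
move=> lq sq [g gK Kg] h; apply: inj_surj_bij => [|y].
  apply: lin_inj => [a x y|x]; first by rewrite scalerDr !scalerA mulrC.
  by have [y <-] := sq x; rewrite -(linZ lq) => /h.
have [x <-] := sq y; exists (q (g x)).
by rewrite -(linZ lq) Kg.
Qed.

(** * Reflection into modules killed by some r_k and s-divisible *)

Section Reflection.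
Variables (R : comPzRingType) (m : nat) (r : 'I_m -> R).
Implicit Types (Z : {set 'I_m}) (s : R).

Definition killed_part Z (M : lmodType R) (x : M) : Prop :=
  exists e : 'I_m -> M, x = \sum_(k in Z) r k *: e k.

(** For [Z = ~: J] and [s] the product over [J], these are the R_J-modules; being one is thus a
    property of an R-module. *)
Definition in_class Z s (M : lmodType R) : Prop :=
  (forall k, k \in Z -> forall x : M, r k *: x = 0) /\ s_bijective s M.

Lemma killed_part_submod Z (M : lmodType R) : is_submod (@killed_part Z M).
Proof.
split.
  by exists (fun _ => 0); rewrite big1 // => i _; rewrite scaler0.
move=> a _ _ [e ->] [f ->]; exists (fun k => a *: e k + f k).
rewrite scaler_sumr -big_split; apply: eq_bigr => k _ /=.
by rewrite scalerDr !scalerA mulrC.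
Qed.

Lemma killed_part_gen Z (M : lmodType R) k (x : M) :
  k \in Z -> killed_part Z (r k *: x).
Proof.
move=> kZ; exists (fun j => if j == k then x else 0).
rewrite (bigD1 k) //= eqxx big1 ?addr0 // => j /andP[_ /negbTE ->].
by rewrite scaler0.
Qed.

Lemma in_class_killed Z s (M : lmodType R) (x : M) :
  in_class Z s M -> killed_part Z x -> x = 0.
Proof. by move=> [h _] [e ->]; rewrite big1 // => k kZ; exact: h. Qed.

Lemma killed_part_lin Z (M N : lmodType R) (f : M -> N) x :
  linear f -> killed_part Z x -> killed_part Z (f x).
Proof.
move=> lf [e ->]; exists (fun k => f (e k)).
by rewrite (lin_sum lf); apply: eq_bigr => k _; rewrite (linZ lf).
Qed.

Lemma in_class_inj Z s n (M : lmodType R) (x y : M) :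
  in_class Z s M -> s ^+ n *: x = s ^+ n *: y -> x = y.
Proof.
move=> [_ b]; elim: n => [|n IH]; first by rewrite expr0 !scale1r.
by rewrite exprS -!scalerA => /(bij_inj b).
Qed.

Lemma in_class_surj Z s n (M : lmodType R) (y : M) :
  in_class Z s M -> exists x, s ^+ n *: x = y.
Proof.
move=> [_ [g _ gK]]; elim: n y => [|n IH] y.
  by exists y; rewrite expr0 scale1r.
have [x hx] := IH (g y); exists x.
by rewrite exprS -scalerA hx gK.
Qed.

(* M' is (M / sum_(k in Z) r_k M)[1/s], characterized elementwise. *)
Definition is_reflection Z s (M M' : lmodType R) (la : M -> M') : Prop :=
  [/\ linear la, in_class Z s M',
      forall e, la e = 0 -> exists n, killed_part Z (s ^+ n *: e) &
      forall y, exists n e, s ^+ n *: y = la e].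

(* The colimit of M -> M -> ... along s, realized as sequences that eventually
   satisfy x_(n+1) = s x_n modulo sum_(k in Z) r_k M, up to eventual
   equality modulo the same submodule. *)
Lemma reflect_exists Z s (M : lmodType R) :
  exists (M' : lmodType R) (la : M -> M'), is_reflection Z s la.
Proof.
have sub := killed_part_submod Z M.
pose W (x : nat -> M) :=
  exists N, forall n, (N <= n)%N -> killed_part Z (x n.+1 - s *: x n).
have hW : is_submod W.
  split; first by exists 0%N => n _; rewrite scaler0 subrr; exact: submod0.
  move=> a x y [N hN] [N' hN']; exists (maxn N N') => n.
  rewrite geq_max => /andP[/hN hx /hN' hy].
  rewrite !addrfctE !scalrfctE scalerDr scalerA [s * a]mulrC -scalerA.
  rewrite opprD addrACA -scalerBr; exact: (proj2 sub).
have [Y [v [lv iv vW]]] := sub_exists hW.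
pose K (y : Y) := exists N, forall n, (N <= n)%N -> killed_part Z (v y n).
have hK : is_submod K.
  split; first by exists 0%N => n _; rewrite (lin0 lv); exact: submod0.
  move=> a x y [N hN] [N' hN']; exists (maxn N N') => n.
  rewrite geq_max => /andP[/hN hx /hN' hy].
  by rewrite lv addrfctE scalrfctE; exact: (proj2 sub).
have [M' [q [lq sq qK]]] := quot_exists hK.
have [t ht] : exists t : M -> Y, forall e, v (t e) = fun n => s ^+ n *: e.
  apply: (@ex_choice _ _ (fun e y => v y = fun n => s ^+ n *: e)) => e.
  apply/vW; exists 0%N => n _.
  by rewrite scalerA -exprS subrr; exact: submod0.
have lt : linear t.
  move=> a x y; apply: iv; apply/funext => n.
  by rewrite lv addrfctE scalrfctE !ht scalerDr !scalerA mulrC.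
exists M', (q \o t); split.
- by move=> a x y /=; rewrite lt lq.
- split=> [k kZ x|].
    have [y <-] := sq x; rewrite -(linZ lq); apply/qK; exists 0%N => n _.
    by rewrite (linZ lv) scalrfctE; exact: killed_part_gen.
  apply: inj_surj_bij => [|y].
    apply: lin_inj => [a x y|x].
      by rewrite scalerDr !scalerA mulrC.
    have [y <-] := sq x; rewrite -(linZ lq) => /qK [N hN]; apply/qK.
    have [N' hN'] : W (v y) by apply/vW; exists y.
    (* The bound grows by one: [x_(n+1)] lies in the submodule because [s x_n] and [x_(n+1) - s x_n]
       do. *)
    exists (maxn N N').+1 => -[//|n]; rewrite ltnS geq_max => /andP[/hN hx /hN' hy].
    rewrite (linZ lv) scalrfctE in hx.
    by have := submodD sub hy hx; rewrite subrK.
  have [x <-] := sq y.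
  have [N hN] : W (v x) by apply/vW; exists x.
  (* Dividing by [s] delays the sequence by one place. *)
  have [x' hx'] : exists x', v x' = fun n => v x n.-1.
    apply/vW; exists N.+1 => -[//|n] hn /=; exact: hN.
  exists (q x'); rewrite -(linZ lq); apply/eqP; rewrite -subr_eq0; apply/eqP.
  rewrite -(linB lq); apply/qK; exists N.+1 => -[//|n] /hN hn.
  rewrite (linB lv) (linZ lv) hx'.
  change (killed_part Z (s *: v x n - v x n.+1)).
  by rewrite -opprB; exact: submodN.
- move=> e /qK [N hN]; exists N; have := hN N (leqnn _); by rewrite ht.
(* From [N] on the sequence is geometric modulo the submodule, so [s ^+ N] times its class is the
   image of the entry [v x N]. *)
- move=> y; have [x <-] := sq y.
  have [N hN] : W (v x) by apply/vW; exists x.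
  exists N, (v x N); rewrite -(linZ lq); apply/eqP; rewrite -subr_eq0; apply/eqP.
  rewrite -(linB lq); apply/qK; exists N => n hn.
  rewrite (linB lv) (linZ lv) ht.
  change (killed_part Z (s ^+ N *: v x n - s ^+ n *: v x N)).
  elim: n hn => [|n IH]; first rewrite leqn0 => /eqP ->.
    by rewrite subrr; exact: submod0.
  rewrite leq_eqVlt => /orP[/eqP ->|]; first by rewrite subrr; exact: submod0.
  rewrite ltnS => Nn; have h := IH Nn.
  have := submodD sub (submodZ sub (s ^+ N) (hN _ Nn)) (submodZ sub s h).
  by rewrite !scalerBr !scalerA -exprS -exprSr -exprS addrA subrK.
Qed.

(** Clearing denominators: if [s ^+ n *: y = la x], then [y] must go to the [d] with
    [s ^+ n *: d = h x]. *)
Lemma reflection_univ Z s (M M' D : lmodType R) (la : M -> M') (h : M -> D) :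
  is_reflection Z s la -> in_class Z s D -> linear h ->
  exists g : M' -> D, linear g /\ forall x, g (la x) = h x.
Proof.
move=> [lla cM' kla sla] cD lh.
have [|||g [lg _ gE]] := @linear_of_relation R M' D
   (fun y d => exists n x, s ^+ n *: y = la x /\ s ^+ n *: d = h x).
- move=> y; have [n [x e]] := sla y.
  by have [d hd] := in_class_surj n (h x) cD; exists d, n, x.
- move=> a y y' d d' [n [x [hy hd]]] [n' [x' [hy' hd']]].
  exists (n + n')%N, (a *: (s ^+ n' *: x) + s ^+ n *: x').
  rewrite lla lh !(linZ lla) !(linZ lh) -hy -hd -hy' -hd'.
  have e : s ^+ (n + n') * a = a * s ^+ n' * s ^+ n.
    by rewrite -mulrA -exprD mulrC addnC.
  by rewrite !scalerDr !scalerA e exprD.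
- move=> d [n [x []]]; rewrite scaler0 => /esym/kla[k hk] hd.
  apply: (@in_class_inj Z s (k + n) _ _ _ cD).
  rewrite scaler0 exprD -scalerA hd -(linZ lh).
  exact/(in_class_killed cD)/killed_part_lin.
exists g; split=> // x; apply: gE; exists 0%N, x.
by rewrite expr0 !scale1r.
Qed.

Lemma reflection_uniq Z s (M M' D : lmodType R) (la : M -> M') (g g' : M' -> D) :
  is_reflection Z s la -> in_class Z s D -> linear g -> linear g' ->
  (forall x, g (la x) = g' (la x)) -> g =1 g'.
Proof.
move=> [_ _ _ sla] cD lg lg' e y; have [n [x hx]] := sla y.
apply: (@in_class_inj Z s n _ _ _ cD).
by rewrite -(linZ lg) -(linZ lg') hx.
Qed.

(** Projectivity tested on the class only. For [Z = ~: J] and [s] the product over [J] it expresses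
    projectivity of R_J (x) X without forming the tensor product. *)
Definition lifts_in_class Z s (X : lmodType R) : Prop :=
  forall (M N : lmodType R) (p : M -> N) (u : X -> N),
    in_class Z s M -> in_class Z s N -> linear p ->
    (forall y, exists x, p x = y) -> linear u ->
    exists w : X -> M, linear w /\ forall x, p (w x) = u x.

(* Since i stays injective after reflection, the reflected sequence is an
   extension inside the class, and the lifting property of X splits it. *)
Lemma retraction_exists Z s (D E X : lmodType R) (i : D -> E) (p : E -> X) :
  lifts_in_class Z s X -> in_class Z s D ->
  linear i -> linear p -> injective i -> (forall x, exists e, p e = x) ->
  (forall e, p e = 0 <-> exists d, i d = e) ->
  (forall d, killed_part Z (i d) -> d = 0) ->
  exists rho : E -> D, linear rho /\ forall d, rho (i d) = d.
Proof.
move=> lX cD li lp ii sp kp pure.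
have [E' [laE rE]] := reflect_exists Z s E.
have [X' [laX rX]] := reflect_exists Z s X.
have [lE cE kE sE] := rE; have [lX' cX kX sX] := rX.
have [|p' [lp' p'E]] := reflection_univ (h := laX \o p) rE cX.
  by move=> a x y /=; rewrite lp lX'.
have sp' y : exists z, p' z = y.
  have [n [x hx]] := sX y; have [e he] := sp x.
  have [z hz] := in_class_surj n (laE e) cE; exists z.
  apply: (@in_class_inj Z s n _ _ _ cX).
  by rewrite -(linZ lp') hz p'E /= he hx.
have iD d : laE (i d) = 0 -> d = 0.
  move/kE => [n]; rewrite -(linZ li) => /pure.
  by rewrite -[X in _ = X](scaler0 _ (s ^+ n)) => /(in_class_inj cD).
(* Exactness in the middle: lifting along [p] the coefficients that witness [laX (p e) = 0] corrects
   a multiple of [e] into the image of [D]. *)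
have kp' z : p' z = 0 -> exists d, z = laE (i d).
  move=> hz; have [n [e he]] := sE z.
  have : laX (p e) = 0.
    by rewrite -[laX _]/((laX \o p) e) -p'E -he (linZ lp') hz scaler0.
  move=> /kX [k [f hf]]; have [f' hf'] := ex_choice (fun j => sp (f j)).
  have : p (s ^+ k *: e - \sum_(j in Z) r j *: f' j) = 0.
    rewrite (linB lp) (linZ lp) hf (lin_sum lp); apply/eqP; rewrite subr_eq0; apply/eqP.
    by apply: eq_bigr => j _; rewrite (linZ lp) hf'.
  move/kp => [d hd]; have [d' hd'] := in_class_surj (k + n) d cD.
  exists d'; apply: (@in_class_inj Z s (k + n) _ _ _ cE).
  rewrite exprD -scalerA he -exprD -(linZ lE) -(linZ lE) -(linZ li) hd' hd (linB lE).
  rewrite (in_class_killed (x := laE (\sum_(j in Z) _)) cE) ?subr0 //.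
  by apply: killed_part_lin => //; exists f'.
have [w [lw wE]] := lX _ _ _ _ cE cX lp' sp' lX'.
(* As [p' (w x) = laX x], the element [laE e - w (p e)] lies in the kernel of [p']; read in [D], it
   is the retraction. *)
have [|||rho [lrho _ rhoE]] := @linear_of_relation R E D
  (fun e d => laE (i d) = laE e - w (p e)).
- move=> e; have [|d hd] := kp' (laE e - w (p e)); last by exists d.
  by rewrite (linB lp') p'E wE subrr.
- move=> a x y d d' h h'; rewrite li !lE lp lw h h'.
  by rewrite scalerBr opprD addrACA.
- by move=> d; rewrite (lin0 lp) (lin0 lE) (lin0 lw) subrr => /iD.
exists rho; split=> // d; apply: rhoE.
have -> : p (i d) = 0 by apply/kp; exists d.
by rewrite (lin0 lw) subr0.
Qed.

End Reflection.

(** * Free presentations of flat modules *)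

(** Each [y] in [F] has its own basis vector [de y]; [co] gives the coordinates, and [H] is the
    module of relations. *)
Record presentation (R : comPzRingType) (F G H : lmodType R) (de : F -> G)
    (co : F -> G -> R^o) (iH : H -> G) (pr : G -> F) : Prop := Presentation {
  co_lin : forall y, linear (co y);
  co_exp : forall x, exists s : seq F, x = \sum_(y <- s) co y x *: de y;
  free_ext : forall (M : lmodType R) (v : F -> M),
    exists g : G -> M, linear g /\ forall y, g (de y) = v y;
  iH_lin : linear iH;
  iH_inj : injective iH;
  pr_lin : linear pr;
  pr_de : forall y, pr (de y) = y;
  pr_ker : forall x, pr x = 0 <-> exists h, iH h = x }.

Lemma presentation_exists (R : comPzRingType) (F : lmodType R) :
  exists (G H : lmodType R) de co iH pr, @presentation R F G H de co iH pr.
Proof.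
have [G [io [c [lio lc cio cexp ext]]]] := direct_sum_exists F R^o.
pose de y := io y 1.
have fext (M : lmodType R) (v : F -> M) :
    exists g : G -> M, linear g /\ forall y, g (de y) = v y.
  have [y a b b'|g [lg gE]] := ext M (fun y (a : R^o) => a *: v y).
    by rewrite scalerDl scalerA.
  by exists g; split=> // y; rewrite gE scale1r.
have [pr [lpr prE]] := fext F id.
have hK : is_submod (fun x => pr x = 0).
  by split=> [|a x y hx hy]; [exact: lin0|rewrite lpr hx hy scaler0 addr0].
have [H [iH [lH iiH kH]]] := sub_exists hK.
exists G, H, de, (fun y x => c x y), iH, pr; split=> // x.
have [s xE] := cexp x; exists s; rewrite {1}xE; apply: eq_bigr => y _.
by rewrite /de -(linZ (lio y)) -[c x y in LHS]mulr1.
Qed.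

Section Free.
Variables (R : comPzRingType) (F G H : lmodType R) (de : F -> G).
Variables (co : F -> G -> R^o) (iH : H -> G) (pr : G -> F).
Hypothesis pP : presentation de co iH pr.

Lemma free_eq (M : lmodType R) (g g' : G -> M) :
  linear g -> linear g' -> (forall y, g (de y) = g' (de y)) -> g =1 g'.
Proof.
move=> lg lg' e x; have [s ->] := co_exp pP x.
rewrite (lin_sum lg) (lin_sum lg'); apply: eq_bigr => y _.
by rewrite (linZ lg) (linZ lg') e.
Qed.

Lemma free_lift (M N : lmodType R) (p : M -> N) (u : G -> N) :
  linear p -> (forall y, exists x, p x = y) -> linear u ->
  exists w : G -> M, linear w /\ forall x, p (w x) = u x.
Proof.
move=> lp sp lu; have [v hv] := ex_choice (fun y => sp (u (de y))).
have [w [lw wE]] := free_ext pP v; exists w; split=> //.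
apply: (@free_eq _ (p \o w)) => // [a x y|y] /=; first by rewrite lw lp.
by rewrite wE.
Qed.

(* Flatness gives (aG :&: H) = aH: injectivity of a (x) F -> F, with a (x) F
   built as a quotient of the direct sum of copies of a indexed by F. *)
Lemma flat_kill (a : R^o -> Prop) (C : lmodType R) (v : H -> C) (x : H) :
  flat F -> is_submod a -> linear v -> (forall t y, a t -> t *: v y = 0) ->
  (forall y, a (co y (iH x))) -> v x = 0.
Proof.
move=> hF ha lv av ax.
have [A [f [lf ff fE]]] := sub_exists ha.
have [X [io [c [lio lc cio cexp ext]]]] := direct_sum_exists F A.
(* Linearity in the element of [a] is built into the direct sum, so only linearity in [F] is
   imposed; these relations generate [K]. *)
pose rel (z : X) := (exists y y' t, z = io (y + y') t - io y t - io y' t) \/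
   (exists b y t, z = io (b *: y) t - b *: io y t).
pose K (z : X) := forall Q : X -> Prop, is_submod Q -> (forall z, rel z -> Q z) -> Q z.
have hK : is_submod K.
  split=> [Q hQ _|t z z' hz hz' Q hQ hr]; first exact: submod0 hQ.
  by apply: (proj2 hQ); [exact: hz|exact: hz'].
have Krel z : rel z -> K z by move=> h Q _; exact.
have [TA [q [lq sq qK]]] := quot_exists hK.
pose tA (t : A) (y : F) := q (io y t).
have tAP : is_tensor tA.
  split; first split=> [y t z z'|t b y y'].
  - by rewrite /tA (lio y) lq.
  - rewrite /tA -lq; apply/eqP; rewrite -subr_eq0 -(linB lq); apply/eqP/qK.
    have -> : io (b *: y + y') t - (b *: io y t + io y' t)
      = (io (b *: y + y') t - io (b *: y) t - io y' t) + (io (b *: y) t - b *: io y t).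
      by rewrite addrACA subrK -opprD [X in _ = _ - X]addrC.
    apply: (submodD hK); apply: Krel.
      by left; exists (b *: y), y', t.
    by right; exists b, y, t.
  - move=> M b [lb1 lb2]; have [be [lbe beE]] := ext M (fun y t => b t y) lb1.
    have [z|g [lg gE]] := quot_factor lq sq lbe.
      move/qK => /(_ (fun z => be z = 0)); apply.
        by split=> [|t w w' hw hw']; [exact: lin0|rewrite lbe hw hw' scaler0 addr0].
      move=> w [[y [y' [t ->]]]|[d [y [t ->]]]].
        by rewrite !(linB lbe) !beE (linD (lb2 t)) addrAC addrK subrr.
      by rewrite !(linB lbe) (linZ lbe) !beE (linZ (lb2 t)) subrr.
    exists g; split; first by split=> // t y; rewrite gE beE.
    move=> g' lg' g'E z; have [w <-] := sq z; have [s ->] := cexp w.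
    rewrite !(lin_sum lq) (lin_sum lg) (lin_sum lg'); apply: eq_bigr => y _.
    by rewrite gE beE -g'E.
pose tB (t : R^o) (y : F) := t *: y.
have tBP : is_tensor tB.
  split; first split=> [y t z z'|t b y y'].
  - by rewrite /tB scalerDl scalerA.
  - by rewrite /tB scalerDr !scalerA mulrC.
  - move=> M b [lb1 lb2]; exists (b 1); split.
      split=> // t y; rewrite /tB (linZ (lb2 1)) -(linZ (lb1 y)).
      by congr (b _ y); exact: mulr1.
    by move=> g' lg' g'E y; rewrite -g'E /tB scale1r.
have [|g [[lg gE] _]] := tAP.2 F (fun t y => f t *: y).
  split=> [y t z z'|t b y y']; first by rewrite lf scalerDl scalerA.
  by rewrite scalerDr !scalerA mulrC.
have gi := hF _ _ f lf ff _ _ _ _ tAP tBP g lg gE.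
have [e eE] : exists e : F -> A, forall y, f (e y) = co y (iH x).
  exact: (ex_choice (fun y => (fE _).1 (ax y))).
have [inc [linc incE]] : exists be : X -> G,
    linear be /\ forall y t, be (io y t) = f t *: de y.
  by apply: ext => y t z z'; rewrite lf scalerDl scalerA.
have [s xE] := co_exp pP (iH x).
(* [xi] lifts [iH x] to the sum of copies of [a]. Its class in a (x) F is 0, since it maps to
   [pr (iH x) = 0]. *)
pose xi := \sum_(y <- s) io y (e y).
have incxi : inc xi = iH x.
  by rewrite xE (lin_sum linc); apply: eq_bigr => y _; rewrite incE eE.
have qxi : q xi = 0.
  apply: gi; rewrite (lin0 lg) (lin_sum lq) (lin_sum lg).
  transitivity (pr (iH x)); last by apply/(pr_ker pP); exists x.
  rewrite xE (lin_sum (pr_lin pP)); apply: eq_bigr => y _.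
  by rewrite (linZ (pr_lin pP)) (pr_de pP) gE eE.
have ker w : pr w = 0 -> exists h, iH h = w by move/(pr_ker pP).
(* [inc] sends each relation to [f t] times an element of [H], and [v] kills such multiples by
   [av]. *)
move/qK: qxi => /(_ (fun z => exists2 h, iH h = inc z & v h = 0)) [||h].
- split=> [|t z z' [h hh vh] [h' hh' vh']].
    by exists 0; rewrite ?(lin0 lv) // (lin0 (iH_lin pP)) (lin0 linc).
  by exists (t *: h + h');
    rewrite ?(iH_lin pP) ?lv ?vh ?vh' ?scaler0 ?addr0 // linc hh hh'.
- have af t : a (f t) by apply/fE; exists t.
  move=> z [[y [y' [t ->]]]|[b [y [t ->]]]].
    have [|h hh] := ker (de (y + y') - de y - de y').
      by rewrite !(linB (pr_lin pP)) !(pr_de pP) addrAC addrK subrr.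
    exists (f t *: h); last by rewrite (linZ lv) av.
    by rewrite (linZ (iH_lin pP)) hh !(linB linc) !incE !scalerBr.
  have [|h hh] := ker (de (b *: y) - b *: de y).
    by rewrite !(linB (pr_lin pP)) !(linZ (pr_lin pP)) !(pr_de pP) subrr.
  exists (f t *: h); last by rewrite (linZ lv) av.
  rewrite (linZ (iH_lin pP)) hh !(linB linc) (linZ linc) !incE !scalerBr.
  by rewrite !scalerA mulrC.
- by rewrite incxi => /(iH_inj pP) ->.
Qed.

End Free.

(** * Contraadjusted modules *)

(* Ext^1(R[1/s], C) = 0, computed from R[1/s] = colim (R -> R -> ...). *)
Definition seq_adjusted (R : comPzRingType) (s : R) (C : lmodType R) : Prop :=
  forall c : nat -> C, exists d : nat -> C, forall n, c n = d n - s *: d n.+1.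

Lemma seq_adjusted_quot (R : comPzRingType) (s : R) (X Y : lmodType R) (q : X -> Y) :
  linear q -> (forall y, exists x, q x = y) -> seq_adjusted s X -> seq_adjusted s Y.
Proof.
move=> lq sq aX c; have [c' hc'] := ex_choice (fun n => sq (c n)).
have [d hd] := aX c'; exists (q \o d) => n /=.
by rewrite -(linZ lq) -(linB lq) -hd hc'.
Qed.

(* C' is C^nat modulo eventual equality: the k-th coordinate only has to satisfy
   the first k equations. *)
Lemma reduced_power_exists (R : comPzRingType) (C : lmodType R) :
  exists (C' : lmodType R) (j : C -> C'),
  [/\ linear j, injective j, forall s, seq_adjusted s C' &
      forall m (r : 'I_m -> R) Z s, in_class r Z s C -> in_class r Z s C'].
Proof.
pose K (f : nat -> C) := exists N, forall n, (N <= n)%N -> f n = 0.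
have hK : is_submod K.
  split; first by exists 0%N.
  move=> a x y [N hN] [N' hN']; exists (maxn N N') => n.
  rewrite geq_max => /andP[/hN hx /hN' hy].
  by rewrite addrfctE scalrfctE hx hy scaler0 addr0.
have [C' [q [lq sq qK]]] := quot_exists hK.
exists C', (fun c => q (fun _ => c)); split.
- by move=> a x y; rewrite -lq.
- apply: lin_inj => [a x y|x]; first by rewrite -lq.
  by move/qK => [N /(_ _ (leqnn N))].
- move=> s c; have [c' hc'] := ex_choice (fun n => sq (c n)).
  (* The recursion d_n = c_n + s d_(n+1) is unrolled and cut off after index [k], so coordinate [k]
     satisfies it for n <= k. *)
  pose d n (k : nat) := \sum_(l < k.+1 - n) s ^+ l *: c' (n + l)%N k.
  exists (q \o d) => n /=; rewrite -hc' -(linZ lq) -(linB lq).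
  apply/eqP; rewrite -subr_eq0 -(linB lq); apply/eqP/qK.
  exists n => k nk; change (c' n k - (d n k - s *: d n.+1 k) = 0).
  rewrite /d subSS subSn // big_ord_recl expr0 scale1r addn0.
  rewrite (eq_bigr
    (fun l : 'I_(k - n) => s *: (s ^+ l *: c' (n.+1 + l)%N k))); last first.
    by move=> l _; rewrite scalerA -exprS /= /bump leq0n addnA addn1.
  by rewrite -scaler_sumr addrK subrr.
- move=> m r Z s [kC bC]; split=> [k kZ x|].
    have [y <-] := sq x; rewrite -(linZ lq); apply/qK; exists 0%N => n _.
    exact: kC.
  apply: (bijective_quot_scale lq sq) => [|x /qK [N hN]].
    case: bC => g gK Kg; exists (fun f => g \o f) => f; apply/funext => n /=.
      exact: gK.
    exact: Kg.
  apply/qK; exists N => n /hN hn; apply: (bij_inj bC).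
  by rewrite scaler0.
Qed.

(** With an empty index set the reflection of R kills nothing and only inverts [s]. *)
Lemma localization_exists (R : comPzRingType) (s : R) :
  exists (L : lmodType R) (l : R^o -> L), is_localization s l /\
    is_reflection (fun _ : 'I_0 => 0) set0 s l.
Proof.
have [L [l rL]] := reflect_exists (fun _ : 'I_0 => 0) set0 s R^o.
exists L, l; split=> //; have [ll cL _ _] := rL.
split; first exact: ll.
split; first exact: (proj2 cL).
move=> N h lh bN.
have cN : in_class (fun _ : 'I_0 => 0) set0 s N by split=> // k; rewrite inE.
have [g [lg gE]] := reflection_univ rL cN lh.
exists g; split=> // g' lg' g'E; apply: (reflection_uniq rL cN) => // x.
by rewrite gE g'E.
Qed.

(* The sequence d solving the equations exists in a reduced power C' of C;
   it defines R[1/s] -> C'/C, and a splitting of the pulled back extension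
   corrects d into C. *)
Lemma contraadjusted_seq (R : comPzRingType) (sset : R -> Prop) (C : lmodType R) s :
  contraadjusted sset C -> sset s -> seq_adjusted s C.
Proof.
move=> aC ss c; have [C' [j [lj ij aC' _]]] := reduced_power_exists C.
have [d hd] := aC' s (j \o c).
have hK : is_submod (fun z => exists x, j x = z).
  split; first by exists 0; exact: lin0.
  by move=> a _ _ [x <-] [y <-]; exists (a *: x + y); rewrite lj.
have [Q [q [lq sq qK]]] := quot_exists hK.
have qd n k : s ^+ k *: q (d (n + k)%N) = q (d n).
  elim: k n => [|k IH] n; first by rewrite addn0 scale1r.
  rewrite addnS -addSn exprS -scalerA IH -(linZ lq).
  apply/eqP; rewrite eq_sym -subr_eq0 -(linB lq) -hd; apply/eqP/qK.
  by exists (c n).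
have [L [l [locL rL]]] := localization_exists s.
have [ll cL kL sL] := rL.
(* Modulo [C], d_n = s d_(n+1), so a / s^n can be sent to the class of a d_n. *)
have [|||phi [lphi _ phiE]] := @linear_of_relation R L Q
  (fun y z => exists n a, s ^+ n *: y = l a /\ z = a *: q (d n)).
- by move=> y; have [n [a e]] := sL y; exists (a *: q (d n)), n, a.
- move=> b y y' z z' [n [a [e ->]]] [n' [a' [e' ->]]].
  exists (n + n')%N, (b *: (s ^+ n' *: a) + s ^+ n *: a'); split.
    rewrite ll !(linZ ll) -e -e' scalerDr !scalerA.
    have -> : s ^+ (n + n') * b = b * s ^+ n' * s ^+ n.
      by rewrite -mulrA -exprD mulrC addnC.
    by rewrite exprD.
  change (b *: (a *: q (d n)) + a' *: q (d n') =
          (b * (s ^+ n' * a) + s ^+ n * a') *: q (d (n + n')%N)).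
  rewrite -(qd n n') -(qd n' n) (addnC n' n) scalerDl !scalerA.
  by rewrite (mulrC a') (mulrC (s ^+ n') a) mulrA.
- move=> z [n [a []]]; rewrite scaler0 => /esym/kL [k [f]].
  rewrite big_set0 => hk ->.
  rewrite -(qd n k) scalerA mulrC.
  change (s ^+ k * a = 0) in hk.
  by rewrite hk scale0r.
(* [y n] is 1 / s^n. *)
have [y hy] := ex_choice (fun n => in_class_surj n (l 1) cL).
have phiy n : phi (y n) = q (d n).
  by apply: phiE; exists n, 1; rewrite scale1r.
have yS n : y n = s *: y n.+1.
  by apply: (in_class_inj (n := n) cL); rewrite hy scalerA -exprSr hy.
have hE : is_submod (fun w : L * C' => phi w.1 = q w.2).
  split=> [|a w w' h h']; first by rewrite (lin0 lphi) (lin0 lq).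
  by rewrite /= lphi lq h h'.
have [E [v [lv iv vE]]] := sub_exists hE.
have [i hi] : exists i : C -> E, forall x, v (i x) = (0, j x).
  apply: (@ex_choice _ _ (fun x e => v e = (0, j x))) => x; apply/vE.
  by rewrite /= (lin0 lphi); apply/esym/qK; exists x.
have [|||||sg [lsg sgE]] := aC s ss L l locL E i (fun e => (v e).1).
- move=> a x x'; apply: iv; rewrite lv !hi lj.
  by congr (_, _); rewrite /= scaler0 addr0.
- by move=> a x x'; rewrite lv.
- by move=> x x' /(congr1 v); rewrite !hi => -[/ij].
- move=> a; have [w hw] := sq (phi a).
  have [e he] : exists e, v e = (a, w) by apply/vE; rewrite hw.
  by exists e; rewrite he.
- move=> e; split=> [he|[x <-]]; last by rewrite hi.
  have : phi (v e).1 = q (v e).2 by apply/vE; exists e.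
  rewrite he (lin0 lphi) => /esym/qK [x hx]; exists x; apply: iv.
  by rewrite hi hx -he -surjective_pairing.
(* The lift of 1 / s^n has the class of d_n modulo [C]. These lifts satisfy the homogeneous
   equations, so subtracting them keeps the left-hand sides [c n]. *)
have [d' hd'] : exists d' : nat -> C, forall n, j (d' n) = d n - (v (sg (y n))).2.
  apply: (@ex_choice _ _ (fun n x => j x = d n - (v (sg (y n))).2)) => n.
  apply/qK; rewrite (linB lq) -phiy.
  have <- : phi (v (sg (y n))).1 = q (v (sg (y n))).2 by apply/vE; exists (sg (y n)).
  by rewrite sgE subrr.
exists d' => n; apply: ij; rewrite (linB lj) (linZ lj) !hd' [LHS](hd n).
rewrite scalerBr {1}yS (linZ lsg) (linZ lv) /=.
by rewrite opprB addrA addrNK.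
Qed.

(** * Very flatness from projectivity *)

Section Induction.
Variables (R : comPzRingType) (m : nat) (r : 'I_m -> R) (F : lmodType R).
Hypothesis hF : flat F.
Variables (G H : lmodType R) (de : F -> G) (co : F -> G -> R^o).
Variables (iH : H -> G) (pr : G -> F).
Hypothesis pP : presentation de co iH pr.

Implicit Types (Z U J : {set 'I_m}).

Definition rprod J : R := \prod_(j in J) r j.

Hypothesis liftF : forall J, lifts_in_class r (~: J) (rprod J) F.

(** By the presentation this is Ext^1(F, D) = 0. Adjustedness is asked for [J] containing [U], the
    form that [threads_exists] reproduces. *)
Definition ext_prop Z U : Prop := forall D : lmodType R,
  in_class r Z (rprod U) D -> (forall J, U \subset J -> seq_adjusted (rprod J) D) ->
  forall h : H -> D, linear h ->
  exists k : G -> D, linear k /\ forall x, k (iH x) = h x.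

Let liH := iH_lin pP.
Let lpr := pr_lin pP.

Lemma killed_part_coord Z (a : R) (x : G) y :
  killed_part r Z (a *: x) -> killed_part r Z (a *: co y x : R^o).
Proof. by rewrite -(linZ (co_lin pP y)); apply/killed_part_lin/(co_lin pP). Qed.

Lemma killed_ideal Z s (D : lmodType R) (t : R^o) (x : D) :
  in_class r Z s D -> killed_part r Z t -> t *: x = 0.
Proof.
move=> [kD _] [e ->]; rewrite scaler_suml big1 // => k kZ.
by rewrite -scalerA kD.
Qed.

(** The class consists of R_U-modules, where [liftF] applies: a retraction of the pushout of [iH]
    along [h] extends [h] to [G]. *)
Lemma ext_base U : ext_prop (~: U) U.
Proof.
move=> D cD _ h lh.
have hN : is_submod (fun w : G * D => exists x, w = (iH x, - h x)).
  split; first by exists 0; rewrite (lin0 liH) (lin0 lh) oppr0.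
  move=> a _ _ [x ->] [y ->]; exists (a *: x + y).
  by rewrite liH lh opprD -scalerN.
have [E [q [lq sq qK]]] := quot_exists hN.
have [||p [lp pE]] := quot_factor (h := fun w : G * D => pr w.1) lq sq.
- by move=> a x y /=; rewrite lpr.
- by move=> w /qK [x ->] /=; apply/(pr_ker pP); exists x.
have [||||||rho [lrho rhoE]] :=
  retraction_exists (i := fun d => q (0, d)) (p := p) (@liftF U) cD.
- by move=> a x y; rewrite -lq; congr q; congr (_, _); rewrite /= scaler0 addr0.
- exact: lp.
- apply: lin_inj => [a x y|d /qK [x []]].
    by rewrite -lq; congr q; congr (_, _); rewrite /= scaler0 addr0.
  move=> /esym; rewrite -(lin0 liH) => /(iH_inj pP) -> ->.
  by rewrite (lin0 lh) oppr0.
- by move=> x; exists (q (de x, 0)); rewrite pE /= (pr_de pP).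
- move=> e; split=> [|[d <-]]; last by rewrite pE /= (lin0 lpr).
  have [[g d] <-] := sq e; rewrite pE /= => /(pr_ker pP) [x xE].
  exists (d + h x); apply/eqP; rewrite -subr_eq0 -(linB lq); apply/eqP/qK.
  exists (- x); rewrite (linN liH) (linN lh) opprK xE.
  by congr (_, _); rewrite /= ?sub0r // addrAC subrr add0r.
(* Purity: if [(0, d)] is a combination of the r_k modulo a relation [(iH x, - h x)], the
   coordinates of [iH x] lie in the ideal of these r_k. Then [flat_kill] gives [h x = 0], and [d] is
   such a combination inside [D], hence 0. *)
- move=> d [e he]; have [w hw] := ex_choice (fun k => sq (e k)).
  have : q ((0, d) - \sum_(k in ~: U) r k *: w k) = 0.
    rewrite (linB lq) he (lin_sum lq); apply/eqP; rewrite subr_eq0; apply/eqP.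
    by apply: eq_bigr => k _; rewrite (linZ lq) hw.
  move/qK => [x hx].
  have e1 : iH x = - \sum_(k in ~: U) r k *: (w k).1.
    have := congr1 fst hx; rewrite /= sub0r => <-; congr (- _).
    by rewrite (@lin_sum _ (G * D)%type G fst).
  have e2 : d - \sum_(k in ~: U) r k *: (w k).2 = - h x.
    have := congr1 snd hx; rewrite /= => <-; congr (_ - _).
    by rewrite (@lin_sum _ (G * D)%type D snd).
  have hx0 : h x = 0.
    apply: (@flat_kill _ _ _ _ _ _ _ _ pP
      (@killed_part R m r (~: U) R^o) D h x hF) => //.
    - exact: killed_part_submod.
    - by move=> t y kt; apply: killed_ideal cD kt.
    - move=> y; rewrite -[co _ _](scale1r (_ : R^o)).
      apply: killed_part_coord; rewrite scale1r e1.
      by apply: (submodN (killed_part_submod _ _ _)); exists (fun k => (w k).1).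
  move: e2; rewrite hx0 oppr0 => /eqP; rewrite subr_eq0 => /eqP ->.
  by apply: (in_class_killed cD); exists (fun k => (w k).2).
exists (fun g => rho (q (g, 0))); split=> [a x y|x].
  by rewrite -lrho -lq; congr (rho (q (_, _))); rewrite /= scaler0 addr0.
rewrite -[RHS]rhoE; congr rho; apply/eqP; rewrite -subr_eq0 -(linB lq); apply/eqP/qK.
by exists x; congr (_, _); rewrite /= ?subr0 ?sub0r.
Qed.

(* Embed M in a contraadjusted M' of the same class; the map H -> M'/ker p
   extends to G, hence lifts to M', and its restriction to H falls into M. *)
Lemma lifts_of_ext Z U : ext_prop Z U -> lifts_in_class r Z (rprod U) H.
Proof.
move=> ext M N p u cM cN lp sp lu.
have [M' [j [lj ij aM' cM']]] := reduced_power_exists M.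
have {}cM' := cM' _ _ _ _ cM.
have hK : is_submod (fun z => exists2 x, j x = z & p x = 0).
  split; first by exists 0; [exact: lin0|exact: lin0].
  move=> a _ _ [x <- hx] [y <- hy]; exists (a *: x + y); rewrite ?lj ?lp //.
  by rewrite hx hy scaler0 addr0.
have [Q [q [lq sq qK]]] := quot_exists hK.
have cQ : in_class r Z (rprod U) Q.
  split=> [k kZ x|].
    by have [y <-] := sq x; rewrite -(linZ lq) (proj1 cM') ?(lin0 lq).
  apply: (bijective_quot_scale lq sq) => [|x /qK [y jy py]]; first exact: (proj2 cM').
  have [y' hy'] := in_class_surj 1 y cM; rewrite expr1 in hy'.
  apply/qK; exists y'.
    by apply: (bij_inj (proj2 cM')); rewrite -(linZ lj) hy'.
  by apply: (bij_inj (proj2 cN)); rewrite -(linZ lp) hy' scaler0.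
(* [phi] is the map from N = M / ker p to M' / ker p induced by [j]. *)
have [|||phi [lphi _ phiE]] := @linear_of_relation R N Q
  (fun y z => exists2 x, p x = y & z = q (j x)).
- by move=> y; have [x hx] := sp y; exists (q (j x)), x.
- move=> a _ _ _ _ [x <- ->] [x' <- ->]; exists (a *: x + x'); by rewrite ?lp ?lj ?lq.
- by move=> _ [x px ->]; apply/qK; exists x.
have [||k [lk kE]] := ext Q cQ _ (phi \o u).
- by move=> J _; apply: (seq_adjusted_quot lq sq).
- by move=> a x y /=; rewrite lu lphi.
have [w [lw wE]] := free_lift pP lq sq lk.
have [|||f [lf fE _]] := @linear_of_relation R H M
  (fun x y => j y = w (iH x) /\ p y = u x).
- move=> x; have [y py] := sp (u x).
  have : q (w (iH x) - j y) = 0.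
    rewrite (linB lq) wE kE /= (phiE (u x) (q (j y))) ?subrr //.
    by exists y.
  move/qK => [y' jy' py']; exists (y' + y).
  by rewrite (linD lj) (linD lp) jy' py' subrK add0r.
- move=> a x y z z' [h1 h2] [h3 h4].
  by rewrite lj lp lu liH lw h1 h2 h3 h4.
- by move=> y [h _]; apply: ij; rewrite h (lin0 liH) (lin0 lw) (lin0 lj).
by exists f; split=> // x; have [] := fE x.
Qed.


Lemma rprod_setU1 i U : i \notin U -> rprod (i |: U) = r i * rprod U.
Proof. by move=> iU; rewrite /rprod big_setU1. Qed.

(** * Induction step: absorbing a remaining index [i] into [Z] or [U] *)

Section Step.
Variables (Z U : {set 'I_m}) (i : 'I_m).
Hypotheses (iZ : i \notin Z) (iU : i \notin U).
Hypothesis extZ : ext_prop (i |: Z) U.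
Hypothesis extU : ext_prop Z (i |: U).
Variable C : lmodType R.
Hypothesis cC : in_class r Z (rprod U) C.
Hypothesis aC : forall J, U \subset J -> seq_adjusted (rprod J) C.

(* The extension of H by C[r_i] obtained by pulling r_i : C -> r_i C back along w
   splits. *)
Lemma lift_scaled (w : H -> C) : linear w -> (forall x, exists c, r i *: c = w x) ->
  exists w' : H -> C, linear w' /\ forall x, r i *: w' x = w x.
Proof.
move=> lw dw.
have hD : is_submod (fun c : C => r i *: c = 0).
  split=> [|a x y hx hy]; first exact: scaler0.
  by rewrite scalerDr hy addr0 scalerA mulrC -scalerA hx scaler0.
have [D [v [lv iv vD]]] := sub_exists hD.
have cD : in_class r (i |: Z) (rprod U) D.
  split=> [k|].
    rewrite in_setU1 => /orP[/eqP ->|kZ] x; apply: iv; rewrite (linZ lv) (lin0 lv).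
      by apply/vD; exists x.
    by rewrite (proj1 cC).
  apply: (bijective_sub_scale lv iv (proj2 cC)) => y c hc; apply/vD.
  apply: (bij_inj (proj2 cC)); rewrite scaler0 scalerA mulrC -scalerA hc.
  by apply/vD; exists y.
have hE : is_submod (fun z : H * C => w z.1 = r i *: z.2).
  split=> [|a x y hx hy]; first by rewrite (lin0 lw) scaler0.
  by rewrite /= lw hx hy scalerDr !scalerA mulrC.
have [E [e [le ie eE]]] := sub_exists hE.
have eP z : w (e z).1 = r i *: (e z).2 by apply/eE; exists z.
have [inj hinj] : exists inj : D -> E, forall d, e (inj d) = (0, v d).
  apply: (@ex_choice _ _ (fun d z => e z = (0, v d))) => d; apply/eE.
  rewrite /= (lin0 lw); apply/esym.
  by apply/vD; exists d.
have linj : linear inj.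
  move=> a x y; apply: ie; rewrite le !hinj lv.
  by congr (_, _); rewrite /= scaler0 addr0.
have [||||||rho [lrho rhoE]] := retraction_exists (i := inj) (p := fun z => (e z).1)
    (lifts_of_ext extZ) cD.
- exact: linj.
- by move=> a x y; rewrite le.
- by move=> x y /(congr1 e); rewrite !hinj => -[/iv].
- move=> x; have [c hc] := dw x.
  have [z hz] : exists z, e z = (x, c) by apply/eE; rewrite hc.
  by exists z; rewrite hz.
- move=> z; split=> [hz|[d <-]]; last by rewrite hinj.
  have : r i *: (e z).2 = 0 by rewrite -eP hz (lin0 lw).
  move/vD => [d hd]; exists d; apply: ie.
  by rewrite hinj hd -hz -surjective_pairing.
(* Purity: [v d] is the value of [w] at [(e (f i)).1], and r_i times that element is a combination
   of the r_k, k in Z. Its coordinates lie in the ideal of all t with r_i t in the ideal of these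
   r_k, which annihilates the values of [w] because they lie in r_i C. *)
- move=> d [f]; rewrite big_setU1 //= => /(congr1 e).
  rewrite hinj (linD le) (linZ le) (lin_sum le) => hd.
  have e1 : r i *: (e (f i)).1 = - \sum_(k in Z) r k *: (e (f k)).1.
    apply/eqP; rewrite -addr_eq0; apply/eqP.
    have := congr1 fst hd; rewrite /= (@lin_sum _ (H * C)%type H fst) // => e0.
    by rewrite [RHS]e0; congr (_ + _); apply: eq_bigr => k _; rewrite (linZ le).
  have e2 : v d = r i *: (e (f i)).2.
    have := congr1 snd hd; rewrite /= (@lin_sum _ (H * C)%type C snd) // => ->.
    rewrite big1 ?addr0 // => k kZ.
    by rewrite (linZ le) /= (proj1 cC).
  apply: iv; rewrite e2 (lin0 lv) -eP.
  have ha : is_submod (fun t : R^o => killed_part r Z (r i *: t : R^o)).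
    split=> [|a x y hx hy]; first rewrite scaler0.
      exact: submod0 (killed_part_submod _ _ _).
    rewrite scalerDr scalerA mulrC -scalerA.
    exact: (proj2 (killed_part_submod _ _ _)).
  apply: (@flat_kill _ _ _ _ _ _ _ _ pP _ C w (e (f i)).1 hF ha lw) => [t y ht|y].
    have [c hc] := dw y; rewrite -hc scalerA mulrC.
    exact: (@killed_ideal _ _ _ (r i *: t : R^o) c cC ht).
  apply: killed_part_coord; rewrite -(linZ liH) e1 (linN liH) (lin_sum liH).
  apply: (submodN (killed_part_submod _ _ _)).
  exists (fun k => iH (e (f k)).1); apply: eq_bigr => k _.
  by rewrite (linZ liH).
(* Two choices of [c] over [x] differ by an element of C[r_i]; subtracting [rho] cancels it. *)
have [|||w' [lw' w'E w'2]] := @linear_of_relation R H C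
    (fun x c => exists z, (e z).1 = x /\ c = (e z).2 - v (rho z)).
- move=> x; have [c hc] := dw x.
  have [z hz] : exists z, e z = (x, c) by apply/eE; rewrite hc.
  by exists (c - v (rho z)), z; rewrite hz.
- move=> a x y _ _ [z [<- ->]] [z' [<- ->]]; exists (a *: z + z').
  rewrite le lrho lv; split=> //=.
  by rewrite scalerBr opprD addrACA.
- move=> _ [z [hz ->]].
  have : r i *: (e z).2 = 0 by rewrite -eP hz (lin0 lw).
  move/vD => [d hd].
  have -> : z = inj d by apply: ie; rewrite hinj hd -hz -surjective_pairing.
  by rewrite rhoE hinj subrr.
exists w'; split=> // x; have [z [<- ->]] := w'E x.
rewrite scalerBr eP.
have -> : r i *: v (rho z) = 0 by apply/vD; exists (rho z).
by rewrite subr0.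
Qed.

(** Modulo r_i C, [extZ] extends [h] to [G]. After a lift to [C] the error is pointwise divisible by
    r_i, and [lift_scaled] divides it linearly. *)
Lemma divide_step (h : H -> C) : linear h -> exists (g : G -> C) (h' : H -> C),
  [/\ linear g, linear h' & forall x, h x = g (iH x) + r i *: h' x].
Proof.
move=> lh.
have hK : is_submod (fun c : C => exists c', r i *: c' = c).
  split; first by exists 0; rewrite scaler0.
  move=> a _ _ [x <-] [y <-]; exists (a *: x + y).
  by rewrite scalerDr !scalerA mulrC.
have [Q [q [lq sq qK]]] := quot_exists hK.
have cQ : in_class r (i |: Z) (rprod U) Q.
  split=> [k|].
    rewrite in_setU1 => /orP[/eqP ->|kZ] x; have [y <-] := sq x; rewrite -(linZ lq).
      by apply/qK; exists y.
    by rewrite (proj1 cC) // (lin0 lq).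
  apply: (bijective_quot_scale lq sq (proj2 cC)) => x /qK [c hc]; apply/qK.
  have [c' hc'] := in_class_surj 1 c cC; rewrite expr1 in hc'.
  exists c'; apply: (bij_inj (proj2 cC)).
  by rewrite scalerA mulrC -scalerA hc' hc.
have [||k [lk kE]] := extZ cQ _ (h := q \o h).
- by move=> J UJ; apply: (seq_adjusted_quot lq sq); exact: aC.
- by move=> a x y /=; rewrite lh lq.
have [g [lg gE]] := free_lift pP lq sq lk.
have [||h' [lh' h'E]] := @lift_scaled (fun x => h x - g (iH x)).
- move=> a x y; rewrite lh liH lg.
  by rewrite scalerBr opprD addrACA.
- by move=> x; apply/qK; rewrite (linB lq) gE kE subrr.
by exists g, h'; split=> // x; rewrite h'E addrC subrK.
Qed.

(** Adjustedness holds at r_i r_U; as r_U is invertible on [C], rescaling the nth terms by r_U^n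
    removes it. *)
Lemma seq_adjusted_gen : seq_adjusted (r i) C.
Proof.
move=> c; have [c' hc'] := ex_choice (fun n => in_class_surj n (c n) cC).
have [d hd] := aC (subsetUr [set i] U) c'.
exists (fun n => rprod U ^+ n *: d n) => n.
rewrite -hc' hd rprod_setU1 // scalerBr !scalerA; congr (_ - _ *: _).
by rewrite mulrCA exprSr.
Qed.

(** The equations are solved at each basis vector and extended linearly. *)
Lemma free_divide (g : nat -> G -> C) : (forall n, linear (g n)) ->
  exists d : nat -> G -> C, (forall n, linear (d n)) /\
    forall n x, g n x = d n x - r i *: d n.+1 x.
Proof.
move=> lg; have [b hb] := ex_choice (fun y => seq_adjusted_gen (fun n => g n (de y))).
have [d hd] := ex_choice (fun n => free_ext pP (fun y => b y n)).
exists d; split=> [n|n]; first by have [] := hd n.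
have [ld dE] := hd n; have [ld' dE'] := hd n.+1.
apply: (free_eq pP (lg n)) => [a x y|y]; last by rewrite dE dE' hb.
by rewrite ld ld' scalerDr scalerBr opprD addrACA !scalerA mulrC.
Qed.

(** [T] is Hom(R[1/r_i], C), with a map written as its values at the 1 / r_i^n. *)
Lemma threads_exists : exists (T : lmodType R) (v : T -> nat -> C),
  [/\ linear v, injective v,
    forall t, (forall n, t n = r i *: t n.+1) <-> exists x, v x = t,
    in_class r Z (rprod (i |: U)) T &
    forall J, i |: U \subset J -> seq_adjusted (rprod J) T].
Proof.
have hT : is_submod (fun t : nat -> C => forall n, t n = r i *: t n.+1).
  split=> [n|a x y hx hy n]; first by rewrite scaler0.
  by rewrite !addrfctE !scalrfctE hx hy scalerDr !scalerA mulrC.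
have [T [v [lv iv vT]]] := sub_exists hT.
have vP t n : v t n = r i *: v t n.+1.
  by apply: (proj2 (vT (v t))); exists t.
exists T, v; split=> //.
- split=> [k kZ x|].
    apply: iv; apply/funext => n; rewrite (linZ lv) (lin0 lv) scalrfctE.
    by rewrite (proj1 cC).
  rewrite rprod_setU1 //; apply: inj_surj_bij => [|t].
    apply: lin_inj => [a x y|x hx]; first by rewrite scalerDr !scalerA mulrC.
    apply: iv; apply/funext => n; rewrite (lin0 lv).
    apply: (bij_inj (proj2 cC)); rewrite scaler0 vP scalerA mulrC.
    have := congr1 (fun x => v x n.+1) hx.
    by rewrite (linZ lv) (lin0 lv).
  have [g gK Kg] := proj2 cC.
  (* The shift divides by r_i, and [g] divides by r_U. *)
  have [x hx] : exists x, v x = fun n => g (v t n.+1).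
    apply/vT => n; apply: (can_inj gK) => /=.
    by rewrite Kg scalerA mulrC -scalerA Kg -vP.
  exists x; apply: iv; apply/funext => n.
  by rewrite (linZ lv) scalrfctE hx -scalerA Kg -vP.
- move=> J UJ t.
  have iJ : i \in J by apply: (subsetP UJ); rewrite setU11.
  pose J' := J :\ i.
  have JE : rprod J = r i * rprod J'.
    by rewrite -(rprod_setU1 (U := J')) ?setD1K // !inE eqxx.
  have [e he] := aC (subset_trans (subsetUr _ _) UJ) (fun k => v (t k) 0%N).
  (* [d n k] is position n of the kth solution, and [e] solves position 0. Since r_J = r_i r_J' and
     r_i takes position n+1 to position n, the equation at n+1 computes it from position n. *)
  pose d := fix d n k := if n is n'.+1 then v (t k) n + rprod J' *: d n' k.+1 else e k.
  have dr n k : d n k = r i *: d n.+1 k.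
    elim: n k => [|n IH] k.
      by rewrite /= scalerDr -vP scalerA -JE he subrK.
    rewrite [d n.+1 k]/= [d n.+2 k]/= scalerDr -vP; congr (_ + _).
    by rewrite scalerA mulrC -scalerA -IH.
  have [x hx] : exists x : nat -> T, forall k, v (x k) = fun n => d n k.
    apply: (@ex_choice _ _ (fun k y => v y = fun n => d n k)) => k.
    by apply/vT => n; exact: dr.
  exists x => k; apply: iv; apply/funext => n.
  rewrite (linB lv) (linZ lv) !hx.
  change (v (t k) n = d n k - rprod J *: d n k.+1).
  case: n => [|n]; first by rewrite he.
  by rewrite [d n.+1 k]/= JE mulrC -scalerA -dr addrK.
Qed.

Lemma ext_step (h : H -> C) : linear h ->
  exists k : G -> C, linear k /\ forall x, k (iH x) = h x.
Proof.
move=> lh; pose homs := {h : H -> C | linear h}.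
have [f hf] : exists f : homs -> (G -> C) * homs, forall h : homs,
    linear (f h).1 /\
    forall x, sval h x = (f h).1 (iH x) + r i *: sval (f h).2 x.
  apply: (@ex_choice _ _ (fun (h : homs) (p : (G -> C) * homs) => linear p.1 /\
    forall x, sval h x = p.1 (iH x) + r i *: sval p.2 x)) => -[h0 lh0].
  have [g [h' [lg lh' gE]]] := divide_step lh0.
  by exists (g, exist _ h' lh').
pose hn n : homs := iter n (fun h => (f h).2) (exist _ h lh).
have [d [ld dE]] := free_divide (fun n => (hf (hn n)).1).
have [T [v [lv iv vT cT aT]]] := threads_exists.
have [ka hka] : exists ka : H -> T, forall x,
    v (ka x) = fun n => sval (hn n) x - d n (iH x).
  apply: (@ex_choice _ _ (fun x y => v y = fun n => sval (hn n) x - d n (iH x))) => x.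
  apply/vT => n; rewrite (hf (hn n)).2 dE /= scalerBr.
  by rewrite addrAC [X in X + _]addrAC subrr add0r addrC.
have lka : linear ka.
  move=> a x y; apply: iv; apply/funext => n.
  rewrite lv addrfctE scalrfctE !hka (svalP (hn n)) liH (ld n).
  by rewrite scalerBr opprD addrACA.
have [k [lk kE]] := extU cT aT lka.
(* On [H], position 0 of [k] is h - d_0, so adding d_0 back gives [h]. *)
exists (fun x => v (k x) 0%N + d 0%N x); split=> [a x y|x].
  by rewrite lk lv addrfctE scalrfctE (ld 0%N) scalerDr addrACA.
by rewrite kE hka subrK.
Qed.

End Step.

Lemma ext_all Z U : [disjoint Z & U] -> ext_prop Z U.
Proof.
move En : #|~: (Z :|: U)| => n; elim: n Z U En => [|n IH] Z U En dZU.
  suff -> : Z = ~: U by exact: ext_base.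
  apply/eqP; rewrite eqEsubset -disjoints_subset dZU /=.
  move: En => /eqP; rewrite cards_eq0 setCU => /eqP e.
  by rewrite -(setCK Z) -disjoints_subset -setI_eq0 setIC e.
have [i] : exists i, i \in ~: (Z :|: U) by apply/set0Pn; rewrite -card_gt0 En.
rewrite !inE negb_or => /andP[iZ iU] C cC aC h lh.
have card V : V = i |: (Z :|: U) -> #|~: V| = n.
  move=> ->; move: En; rewrite (cardsD1 i) !inE (negbTE iZ) (negbTE iU) add1n => -[<-].
  by apply: eq_card => k; rewrite !inE negb_or.
apply: (ext_step iZ iU _ _ cC aC lh); apply: IH.
- by apply: card; rewrite setUA.
- by rewrite disjoints_subset subUset sub1set inE iU -disjoints_subset.
- by apply: card; rewrite setUCA.
- rewrite disjoint_sym disjoints_subset subUset sub1set inE iZ.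
  by rewrite -disjoints_subset disjoint_sym.
Qed.

End Induction.

(** * Restriction of scalars and projectivity from very flatness *)

Section Restriction.
Variables (R S : comPzRingType) (phi : {rmorphism R -> S}) (N : lmodType S).

(** The morphism is recorded in the type, so that the R-module instance can depend on it. *)
Definition restrict_scalars of {rmorphism R -> S} : Type := N.
HB.instance Definition _ := GRing.Zmodule.on (restrict_scalars phi).

Definition restrict_scale (a : R) (x : restrict_scalars phi) : restrict_scalars phi :=
  phi a *: (x : N).

Lemma restrict_scalerA a b x :
  restrict_scale a (restrict_scale b x) = restrict_scale (a * b) x.
Proof. by rewrite /restrict_scale scalerA rmorphM. Qed.
Lemma restrict_scale1r : left_id 1 restrict_scale.
Proof. by move=> x; rewrite /restrict_scale rmorph1; exact: scale1r. Qed.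
Lemma restrict_scalerDr : right_distributive restrict_scale +%R.
Proof. by move=> a x y; exact: (scalerDr (phi a) (x : N) (y : N)). Qed.
Lemma restrict_scalerDl x : {morph restrict_scale^~ x : a b / a + b}.
Proof. by move=> a b; rewrite /restrict_scale rmorphD; exact: scalerDl. Qed.

HB.instance Definition _ := GRing.Zmodule_isLmodule.Build R (restrict_scalars phi)
  restrict_scalerA restrict_scale1r restrict_scalerDr restrict_scalerDl.

End Restriction.

Lemma bijective_factor (R : comPzRingType) (a b : R) (N : lmodType R) :
  s_bijective (a * b) N -> s_bijective a N.
Proof.
move=> [g gK Kg]; apply: inj_surj_bij => [x y e|y].
  by apply: (can_inj gK); rewrite /= [a * b]mulrC -!scalerA e.
by exists (b *: g y); rewrite scalerA Kg.
Qed.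

Section RingCond.
Variables (R : comPzRingType) (m : nat) (r : 'I_m -> R).
Implicit Types J : {set 'I_m}.

Lemma rprodD1 J j : j \in J -> rprod r J = r j * rprod r (J :\ j).
Proof. by move=> jJ; rewrite /rprod (big_setD1 j). Qed.

Lemma restrict_scalars_in_class J (S : comPzRingType) (phi : {rmorphism R -> S})
    (N : lmodType S) : ring_cond r J phi ->
  in_class r (~: J) (rprod r J) (restrict_scalars N phi).
Proof.
move=> [h0 h1]; split=> [k|].
  rewrite inE => /h0 hk x.
  by rewrite -[LHS]/(phi (r k) *: (x : N)) hk; exact: (scale0r (x : N)).
have [y hy] : exists y, phi (rprod r J) * y = 1.
  rewrite /rprod; elim/big_rec: _ => [|j z jJ [y hy]].
    by exists 1; rewrite rmorph1 mulr1.
  have [y' hy'] := h1 j jJ; exists (y' * y).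
  by rewrite rmorphM mulrACA hy hy' mulr1.
exists (fun x => y *: (x : N)) => x.
  change (y *: (phi (rprod r J) *: (x : N)) = x).
  by rewrite scalerA mulrC hy scale1r.
change (phi (rprod r J) *: (y *: (x : N)) = x).
by rewrite scalerA hy scale1r.
Qed.

Lemma in_class_contraadjusted J (C : lmodType R) :
  in_class r (~: J) (rprod r J) C -> contraadjusted (rtimes r) C.
Proof.
move=> [kC bC] s [I sE] L l [ll [bL uL]] E i p li lp ii sp kp.
have [IJ|] := boolP (I \subset J).
  have bCs : s_bijective s C.
    move: bC; rewrite /rprod (big_setID I) /= (setIidPr IJ) -sE.
    exact: bijective_factor.
  (* [s] is invertible on both ends of the extension, hence on [E]; the universal property of [L]
     then yields a section from any lift of 1. *)
  have bE : s_bijective s E.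
    apply: inj_surj_bij => [|e].
      apply: lin_inj => [a x y|e he]; first by rewrite scalerDr !scalerA mulrC.
      have : p e = 0.
        by apply: (bij_inj bL); rewrite -(linZ lp) he (lin0 lp) scaler0.
      move=> /kp [c hc]; rewrite -hc -(linZ li) in he.
      have : s *: c = s *: 0 by apply: ii; rewrite he scaler0 (lin0 li).
      by move=> /(bij_inj bCs) c0; rewrite -hc c0 (lin0 li).
    have [g _ Kg] := bL; have [e' he'] := sp (g (p e)).
    have : p (e - s *: e') = 0 by rewrite (linB lp) (linZ lp) he' Kg subrr.
    move=> /kp [c hc]; have [g' _ Kg'] := bCs.
    exists (i (g' c) + e').
    by rewrite scalerDr -(linZ li) Kg' hc subrK.
  have [e0 he0] := sp (l 1).
  have [|g [[lg gE] _]] := uL E (fun a => a *: e0) _ bE.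
    by move=> a x y; rewrite scalerDl scalerA.
  exists g; split=> //.
  have [g1 [_ g1E]] := uL L l ll bL.
  have lx x : l x = x *: l 1.
    by rewrite -(linZ ll); congr l; rewrite -[x in LHS]mulr1.
  have h1 : p \o g =1 g1.
    apply: g1E => [a x y|x] /=; first by rewrite lg lp.
    by rewrite gE (linZ lp) he0 -lx.
  have h2 : id =1 g1 by apply: g1E.
  by move=> a; rewrite -[LHS]/((p \o g) a) h1 -h2.
case/subsetPn => k kI kJ.
have bLk : s_bijective (r k) L.
  by move: bL; rewrite sE (big_setD1 k) //=; exact: bijective_factor.
have [g gK Kg] := bLk.
(* The section lifts a / r_k and multiplies by r_k; two lifts give the same result because r_k kills
   [C]. *)
have [|||sg [lsg sgP _]] := @linear_of_relation R L E
  (fun a e => exists e', r k *: p e' = a /\ e = r k *: e').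
- by move=> a; have [e' he'] := sp (g a); exists (r k *: e'), e'; rewrite he' Kg.
- move=> a _ _ _ _ [e [<- ->]] [e' [<- ->]]; exists (a *: e + e').
  by rewrite lp !scalerDr !scalerA mulrC.
- move=> _ [e [he ->]].
  have : p e = 0 by apply: (bij_inj bLk); rewrite he scaler0.
  by move=> /kp [c <-]; rewrite -(linZ li) kC ?(lin0 li) // inE.
exists sg; split=> // a; have [e [<- ->]] := sgP a.
by rewrite (linZ lp).
Qed.

(** A splitting of the pullback of [p] along [f \o tau] is a lift of [f \o tau] to [M], which the
    base change extends to [P]. *)
Lemma projective_of_very_flat J (S : comPzRingType) (phi : {rmorphism R -> S})
    (F : lmodType R) (P : lmodType S) (tau : F -> P) :
  very_flat (rtimes r) F -> ring_cond r J phi -> is_base_change phi tau ->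
  projective P.
Proof.
move=> vF hJ [[tauD tauZ] uP] M N p f lp lf sp.
have hK : is_submod (fun x : M => p x = 0).
  by split=> [|a x y hx hy]; [exact: lin0|rewrite lp hx hy scaler0 addr0].
have [K [v [lv iv vK]]] := sub_exists hK.
have hE : is_submod (fun w : F * restrict_scalars M phi => f (tau w.1) = p w.2).
  split=> [|a w w' h h'] /=.
    have -> : tau 0 = 0 by rewrite -(scale0r 0) tauZ rmorph0 scale0r.
    by rewrite (lin0 lf); exact/esym/(lin0 lp).
  by rewrite tauD tauZ lf h h' -lp.
have [E [e [le ie eE]]] := sub_exists hE.
have eP z : f (tau (e z).1) = p (e z).2 by apply/eE; exists z.
have [i hi] : exists i : restrict_scalars K phi -> E, forall x, e (i x) = (0, v x).
  apply: (@ex_choice _ _ (fun x z => e z = (0, v x))) => x; apply/eE => /=.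
  have -> : tau 0 = 0 by rewrite -(scale0r 0) tauZ rmorph0 scale0r.
  by rewrite (lin0 lf); apply/esym/vK; exists x.
have aK := in_class_contraadjusted (restrict_scalars_in_class K hJ).
have := vF _ aK E i (fun z => (e z).1).
case=> [a x y|a x y|x y|x|z|s [ls sE]].
- apply: ie; rewrite le !hi; congr (_, _); first by rewrite /= scaler0 addr0.
  exact: (lv (phi a) x y).
- by rewrite le.
- by move/(congr1 e); rewrite !hi => -[/iv].
- have [y hy] := sp (f (tau x)).
  have [z hz] : exists z, e z = (x, y) by apply/eE; rewrite hy.
  by exists z; rewrite hz.
- split=> [hz|[x <-]]; last by rewrite hi.
  have [x hx] : exists x, v x = (e z).2.
    apply/vK; rewrite -eP hz.
    have -> : tau 0 = 0 by rewrite -(scale0r 0) tauZ rmorph0 scale0r.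
    exact: lin0.
  by exists x; apply: ie; rewrite hi hx -hz -surjective_pairing.
have [|g [[lg gE] _]] := uP M (fun x => (e (s x)).2).
  split=> [x y|a x].
    by rewrite (linD ls) (linD le).
  by rewrite (linZ ls) (linZ le).
exists g; split=> //.
have [|g1 [_ g1E]] := uP N (f \o tau).
  by split=> [x y|a x] /=; rewrite ?tauD ?(linD lf) ?tauZ ?(linZ lf).
have h1 : p \o g =1 g1.
  apply: g1E => [a x y|x] /=; first by rewrite lg lp.
  by rewrite gE -eP sE.
have h2 : f =1 g1 by apply: g1E.
by move=> x; rewrite h2 -h1.
Qed.

End RingCond.

(** * The ring R_J *)

Record scalar_action (S : pzRingType) (V : zmodType) (act : S -> V -> V) : Prop :=
  ScalarAction {
    actA : forall a b v, act a (act b v) = act (a * b) v;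
    act1 : left_id 1 act;
    actDr : right_distributive act +%R;
    actDl : forall v, {morph act^~ v : a b / a + b} }.

Section ActionModule.
Variables (S : pzRingType) (V : zmodType) (act : S -> V -> V).
Hypothesis actP : scalar_action act.

Definition action_module of scalar_action act : Type := V.
HB.instance Definition _ := GRing.Zmodule.on (action_module actP).
HB.instance Definition _ := GRing.Zmodule_isLmodule.Build S (action_module actP)
  (actA actP) (act1 actP) (actDr actP) (actDl actP).

End ActionModule.

Section RJ.
Variables (R : comPzRingType) (m : nat) (r : 'I_m -> R) (J : {set 'I_m}).

Let Z := ~: J.
Let s := rprod r J.

Section Action.
Variables (L : lmodType R) (la : R^o -> L).
Hypothesis rL : is_reflection r Z s la.

Let lla : linear la. Proof. by case: rL. Qed.

Lemma reflection_mul1 a : la a = a *: la 1.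
Proof. by rewrite -(linZ lla); congr la; rewrite -[a in LHS]mulr1. Qed.

(** [la 1] generates [L] up to division by powers of [s], which is unique in [D]. *)
Lemma reflection_eq (D : lmodType R) (g g' : L -> D) :
  in_class r Z s D -> linear g -> linear g' -> g (la 1) = g' (la 1) -> g =1 g'.
Proof.
move=> cD lg lg' e; apply: (reflection_uniq rL cD) => // x.
by rewrite reflection_mul1 (linZ lg) (linZ lg') e.
Qed.

(* L = R_J as an R-module acts on every module of the class: x |-> x d is the
   unique linear map from L sending 1 to d. *)
Lemma action_exists (D : lmodType R) : in_class r Z s D ->
  exists act : L -> D -> D,
  [/\ forall d, linear (act^~ d), forall x, linear (act x) &
      forall d, act (la 1) d = d].
Proof.
move=> cD.
have [g hg] : exists g : D -> L -> D, forall d, linear (g d) /\ g d (la 1) = d.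
  apply: (@ex_choice _ _ (fun d (g : L -> D) => linear g /\ g (la 1) = d)) => d.
  have [|g [lg gE]] := reflection_univ (h := fun a : R^o => a *: d) rL cD.
    by move=> a x y; rewrite scalerDl scalerA.
  by exists g; rewrite gE scale1r.
exists (fun x d => g d x); split=> [d|x a d d'|d].
- by have [] := hg d.
- have [l1 e1] := hg d; have [l2 e2] := hg d'; have [l3 e3] := hg (a *: d + d').
  apply: (reflection_eq cD l3 (g' := fun x => a *: g d x + g d' x)).
    move=> b y z; rewrite l1 l2 !scalerDr !scalerA addrACA.
    by rewrite mulrC.
  by rewrite e1 e2 e3.
- by have [] := hg d.
Qed.

End Action.

(** The ring is the reflection of R, multiplied through its action on itself. The last clause
    expresses that R -> R_J is an epimorphism of rings. *)
Lemma RJ_exists : exists (S : comPzRingType) (phi : {rmorphism R -> S}),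
  [/\ is_RJ r J phi,
      forall D : lmodType R, in_class r Z s D ->
        exists (N : lmodType S) (f : D -> N), phi_linear phi f /\ bijective f &
      forall (N N' : lmodType S) (g : N -> N'),
        (forall x y, g (x + y) = g x + g y) ->
        (forall a x, g (phi a *: x) = phi a *: g x) -> linear g].
Proof.
have [L [la rL]] := reflect_exists r Z s R^o.
have [lla cL kL sL] := rL.
have [mul [lml lmr mul1]] := action_exists rL cL.
have mulx1 x : mul x (la 1) = x.
  by apply: (@reflection_eq _ _ rL L (mul^~ (la 1)) id).
have mulC x y : mul x y = mul y x.
  apply: (@reflection_eq _ _ rL L (mul^~ y) (mul y)) => //.
  by rewrite mul1 mulx1.
have act_mul (D : lmodType R) (act : L -> D -> D) : in_class r Z s D ->
    (forall d, linear (act^~ d)) -> (forall x, linear (act x)) ->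
    (forall d, act (la 1) d = d) ->
    forall x y d, act x (act y d) = act (mul x y) d.
  move=> cD l1 l2 a1 x y d.
  apply: (@reflection_eq _ _ rL D (act^~ (act y d)) (fun x => act (mul x y) d)) => //.
    by move=> a x1 x2; rewrite lml l1.
  by rewrite a1 mul1.
have mulA : associative mul by move=> x y z; exact: act_mul.
have mulDl : left_distributive mul +%R.
  by move=> x y z; exact: (linD (lml z)).
pose S : comPzRingType := HB.pack_for comPzRingType (GRing.Lmodule.sort L)
  (GRing.Zmodule_isComPzRing.Build L mulA mulC mul1 mulDl).
pose laS : R -> S := la.
have laM : monoid_morphism laS.
  split=> // a b; change (la (a * b) = mul (la a) (la b)).
  rewrite (linZ lla a (b : R^o) : la (a * b) = _) (reflection_mul1 rL a).
  by rewrite (linZ (lml _)) mul1.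
have laB : zmod_morphism laS.
  by move=> a b; exact: (linB lla).
pose phi : {rmorphism R -> S} := HB.pack laS
  (GRing.isZmodMorphism.Build R S laS laB) (GRing.isMonoidMorphism.Build R S laS laM).
have phiE a (x : L) : mul (la a) x = a *: x.
  by rewrite (reflection_mul1 rL) (linZ (lml _)) mul1.
have cond : ring_cond r J phi.
  split=> [k kJ|j jJ].
    change (la (r k) = 0); rewrite (reflection_mul1 rL).
    by apply: (proj1 cL); rewrite inE.
  have [w hw] := in_class_surj 1 (la 1) cL; rewrite expr1 in hw.
  exists (rprod r (J :\ j) *: w).
  change (mul (la (r j)) (rprod r (J :\ j) *: w) = la 1).
  by rewrite phiE scalerA -rprodD1.
exists S, phi; split.
- split=> // T psi condT.
  have cT := restrict_scalars_in_class T^o condT.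
  have [|chi [lchi chiE]] :=
    reflection_univ (h := psi : R^o -> restrict_scalars T^o psi) rL cT.
    move=> a x y; change (psi (a * x + y) = psi a * psi x + psi y).
    by rewrite rmorphD rmorphM.
  have chi1 : chi (la 1) = 1 by rewrite chiE; exact: rmorph1.
  pose chiS : S -> T := chi.
  have chiM : monoid_morphism chiS.
    split=> // x y; change (chi (mul x y) = (chi x : T) * chi y).
    apply: (@reflection_eq _ _ rL (restrict_scalars T^o psi) (fun x => chi (mul x y))
      (fun x => (chi x : T) * chi y)) => //.
    + by move=> a x1 x2; rewrite lml lchi.
    + move=> a x1 x2; rewrite lchi.
      change ((psi a * (chi x1 : T) + chi x2) * chi y =
         psi a * ((chi x1 : T) * chi y) + (chi x2 : T) * chi y).
      by rewrite mulrDl mulrA.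
    + by rewrite mul1 chi1; exact/esym/mul1r.
  have chiB : zmod_morphism chiS by move=> x y; exact: (linB lchi).
  pose chiR : {rmorphism S -> T} := HB.pack chiS
    (GRing.isZmodMorphism.Build S T chiS chiB)
    (GRing.isMonoidMorphism.Build S T chiS chiM).
  exists chiR; split=> [x|chi' chi'E x]; first exact: chiE.
  apply: (@reflection_eq _ _ rL (restrict_scalars T^o psi) chi' chi) => //.
    move=> a y z; rewrite -(phiE a y).
    change (chi' ((la a : S) * (y : S) + (z : S)) = psi a * chi' y + chi' z).
    by rewrite rmorphD rmorphM -chi'E.
  by rewrite chi1; exact: (rmorph1 chi').
- move=> D cD; have [act [l1 l2 a1]] := action_exists rL cD.
  have actDr : right_distributive (act : S -> D -> D) +%R.
    by move=> x; exact: (linD (l2 x)).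
  have actDl v : {morph (act : S -> D -> D)^~ v : a b / a + b}.
    by move=> a b; exact: (linD (l1 v)).
  have actP : scalar_action (act : S -> D -> D).
    by split=> //; exact: act_mul cD l1 l2 a1.
  exists (action_module actP), id; split; last by exists id.
  split=> // a x; change (a *: x = act (la a) x).
  by rewrite (reflection_mul1 rL) (linZ (l1 _)) a1.
- move=> N N' g gD gZ a x y; rewrite gD; congr (_ + _).
  have cN' := restrict_scalars_in_class N' cond.
  apply: (@reflection_eq _ _ rL (restrict_scalars N' phi) (fun a : S => g (a *: x))
    (fun a : S => a *: g x)) => //.
  + move=> b z w.
    change (g (((b *: z : L) + w : S) *: x) =
      phi b *: g ((z : S) *: x) + g ((w : S) *: x)).
    by rewrite -(phiE b z) -gZ -gD scalerA -scalerDl.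
  + move=> b z w.
    change (((b *: z : L) + w : S) *: g x = phi b *: ((z : S) *: g x) + (w : S) *: g x).
    by rewrite -(phiE b z) scalerA -scalerDl.
Qed.

(** The reflection of [F] is a base change to R_J; the lifting problem is moved to R_J-modules,
    solved by projectivity and moved back. *)
Lemma lifts_of_projective (F : lmodType R) :
  (forall (S : comPzRingType) (phi : {rmorphism R -> S}), is_RJ r J phi ->
     forall (P : lmodType S) (tau : F -> P), is_base_change phi tau ->
       projective P) ->
  lifts_in_class r Z s F.
Proof.
move=> hP M N p u cM cN lp sp lu.
have [S [phi [RJ mod_exists lin_phi]]] := RJ_exists.
have [F' [la rF]] := reflect_exists r Z s F; have [lla cF _ _] := rF.
have [P [f [[fD fZ] [fi fK Kf]]]] := mod_exists F' cF.
have fiD x y : fi (x + y) = fi x + fi y.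
  by apply: (can_inj fK); rewrite Kf fD !Kf.
have fiZ a x : fi (phi a *: x) = a *: fi x.
  by apply: (can_inj fK); rewrite Kf fZ !Kf.
have bc : is_base_change phi (f \o la).
  split; first by split=> [x y|a x] /=; rewrite ?(linD lla) ?fD ?(linZ lla) ?fZ.
  move=> N' h [hD hZ]; have cN' := restrict_scalars_in_class N' (proj1 RJ).
  have lh : linear (h : F -> restrict_scalars N' phi) by move=> a x y; rewrite hD hZ.
  have [g [lg gE]] := reflection_univ rF cN' lh.
  exists (g \o fi); split.
    split=> [|x]; last by rewrite /= fK gE.
    apply: lin_phi => [x y|a x] /=.
      by rewrite fiD; exact: (linD lg).
    by rewrite fiZ; exact: (linZ lg).
  move=> g' lg' g'E x /=; rewrite -[in LHS](Kf x).
  apply: (@reflection_uniq _ _ _ Z s _ _ (restrict_scalars N' phi)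
    la (g' \o f) g rF cN') => //.
    by move=> a y z /=; rewrite fD fZ lg'.
  by move=> y; rewrite gE -g'E.
have [M1 [fM [[MD MZ] [Mi MK KM]]]] := mod_exists M cM.
have [N1 [fN [[ND NZ] [Ni NK KN]]]] := mod_exists N cN.
have MiD x y : Mi (x + y) = Mi x + Mi y.
  by apply: (can_inj MK); rewrite KM MD !KM.
have MiZ a x : Mi (phi a *: x) = a *: Mi x.
  by apply: (can_inj MK); rewrite KM MZ !KM.
have [|g [[lg gE] _]] := bc.2 N1 (fN \o u).
  by split=> [x y|a x] /=; rewrite ?(linD lu) ?ND ?(linZ lu) ?NZ.
have [|||k [lk kE]] := hP S phi RJ P _ bc M1 N1 (fN \o p \o Mi) g.
- by apply: lin_phi => [x y|a x] /=;
    rewrite ?MiD ?(linD lp) ?ND ?MiZ ?(linZ lp) ?NZ.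
- exact: lg.
- move=> y; have [x hx] := sp (Ni y); exists (fM x).
  by rewrite /= MK hx KN.
exists (fun x => Mi (k (f (la x)))); split=> [a x y|x].
  by rewrite lla fD fZ lk MiD MiZ.
by apply: (can_inj NK); have := kE (f (la x)); rewrite gE.
Qed.

End RJ.

(** * Assembly of the two implications *)

Theorem theorem1p8 (R : comPzRingType) (m : nat) (r : 'I_m -> R)
    (F : lmodType R) (hF : flat F) :
  very_flat (rtimes r) F <->
  (forall (J : {set 'I_m}) (S : comPzRingType) (phi : {rmorphism R -> S}),
     is_RJ r J phi ->
     forall (P : lmodType S) (tau : F -> P), is_base_change phi tau ->
       projective P).
Proof.
split=> [vF J S phi RJ P tau|hP C aC E i p li lp ii sp kp].
  exact: (projective_of_very_flat vF (proj1 RJ)).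
have [G [H [de [co [iH [pr pP]]]]]] := presentation_exists F.
have lift J : lifts_in_class r (~: J) (rprod r J) F.
  exact/lifts_of_projective/hP.
(* [w] lifts [pr] to [E] and maps [H] into [C]. Subtracting an extension [k] of that restriction
   makes it vanish on [H], so it descends to a splitting of [p]. *)
have [w [lw wE]] := free_lift pP lp sp (pr_lin pP).
have wi x : exists c, i c = w (iH x).
  by apply/kp; rewrite wE; apply/(pr_ker pP); exists x.
have [h hE] := ex_choice wi.
have lh : linear h.
  by move=> a x y; apply: ii; rewrite li !hE (iH_lin pP) lw.
(* For [Z] and [U] empty the class is all modules, the empty product being 1. *)
have cC : in_class r set0 (rprod r set0) C.
  split=> [k|]; first by rewrite inE.
  by rewrite /rprod big_set0; exists id => x; rewrite scale1r.
have [||k [lk kE]] := ext_all hF pP lift _ cC _ lh.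
- by rewrite disjoint_sym disjoints_subset sub0set.
- by move=> J _; apply: (contraadjusted_seq aC); exists J.
have [||||g [lg gE]] := quot_factor (q := pr) (h := fun x => w x - i (k x)).
- exact: pr_lin pP.
- by move=> y; exists (de y); exact: pr_de pP y.
- by move=> a x y; rewrite lw lk li scalerBr opprD addrACA.
- by move=> x /(pr_ker pP) [y <-]; rewrite kE hE subrr.
exists g; split=> // y; rewrite -(pr_de pP y) gE (linB lp) wE.
have -> : p (i (k (de y))) = 0 by apply/kp; exists (k (de y)).
by rewrite subr0.
Qed.
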